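(* Let $Z$ be an ICLP with mean $0$ and covariance operator $C$, let $\sigma>0$, and let $f,g\in\mathbb{H}$. Let $P_f$ and $P_g$ denote the laws on the Borel $\sigma$-algebra of $\mathbb{H}$ of $f+\sigma Z$ and $g+\sigma Z$ respectively. Then $P_f$ and $P_g$ are mutually absolutely continuous (equivalent) if and only if $f-g\in\mathcal{H}_C$. In particular, for a functional summary $D\mapsto f_D\in\mathbb{H}$ and adjacent datasets $D,D'$, the laws $P_D,P_{D'}$ of $f_D+\sigma Z$, $f_{D'}+\sigma Z$ are equivalent iff $f_D-f_{D'}\in\mathcal{H}_C$.
   Context: $\mathbb{H}$ is a real separable infinite-dimensional Hilbert space. $C$ is a covariance operator on $\mathbb{H}$ (self-adjoint, positive semidefinite, trace class) with eigenvalues $\lambda_1\ge\lambda_2\ge\dots>0$ and eigenvectors $\{\phi_j\}_{j\ge1}$ forming an orthonormal basis of $\mathbb{H}$. For $h\in\mathbb{H}$ write $h_j=\langle h,\phi_j\rangle$. Define $\|h\|_C=\big(\sum_{j\ge1}h_j^2/\lambda_j\big)^{1/2}$ and $\mathcal{H}_C=\{h\in\mathbb{H}:\|h\|_C<\infty\}$. An ICLP with mean $\mu$ and covariance operator $C$ is the random element $\mu+\sum_{j\ge1}\sqrt{\lambda_j}Z_j\phi_j$ (series converging in $L^2(\Omega;\mathbb{H})$), where $Z_j$ are i.i.d. Laplace with mean $0$ and variance $1$, i.e. with density $\frac1{\sqrt2}e^{-\sqrt2|x|}$. Datasets are elements of a collection $\mathcal{D}$ of $n$-record databases; $D,D'$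 are adjacent if they differ in exactly one record. *)

(* Defs.v *)
From HB Require Import structures.
From mathcomp Require Import all_boot all_order all_algebra.
From mathcomp Require Import all_classical all_reals all_analysis.
Set Implicit Arguments. Unset Strict Implicit. Unset Printing Implicit Defensive.
Import Order.TTheory GRing.Theory Num.Theory.
Import numFieldNormedType.Exports.
Local Open Scope classical_set_scope.
Local Open Scope ring_scope.

(* A real inner product on a normed module whose norm is induced by it.
   Together with completeness of H this makes H a real Hilbert space. *)
Definition is_inner_product {R : realType} {H : normedModType R}
  (ip : H -> H -> R) : Prop :=
  (forall x y, ip x y = ip y x) /\
  (forall (a : R) (x y z : H), ip (a *: x + y) z = a * ip x z + ip y z) /\
  (forall x, ip x x = `|x| ^+ 2).

Definition is_ONB {R : realType} {H : normedModType R}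
  (ip : H -> H -> R) (phi : nat -> H) : Prop :=
  (forall i j, ip (phi i) (phi j) = (i == j)%:R) /\
  (forall h : H, (fun n => \sum_(j < n) ip h (phi j) *: phi j) @ \oo --> h).

Definition covariance_eigen {R : realType} {H : normedModType R}
  (ip : H -> H -> R) (C : H -> H) (lam : nat -> R) (phi : nat -> H) : Prop :=
  (forall (a : R) (x y : H), C (a *: x + y) = a *: C x + C y) /\
  (forall x y, ip (C x) y = ip x (C y)) /\
  (forall x, 0 <= ip (C x) x) /\
  is_ONB ip phi /\
  (forall j, C (phi j) = lam j *: phi j) /\
  (forall j, 0 < lam j) /\
  (forall j, lam j.+1 <= lam j) /\
  cvg (series lam @ \oo) (* trace class: sum_j lam_j < oo *).

Definition in_HC {R : realType} {H : normedModType R}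
  (ip : H -> H -> R) (lam : nat -> R) (phi : nat -> H) (h : H) : Prop :=
  cvg (series (fun j => ip h (phi j) ^+ 2 / lam j) @ \oo).

Definition borelH {R : realType} (H : normedModType R) :=
  g_sigma_algebraType (@open H).

Definition mutually_independent {d} {Omega : measurableType d} {R : realType}
  (P : probability Omega R) (X : nat -> Omega -> R) : Prop :=
  forall (s : seq nat) (A : nat -> set R), uniq s ->
    (forall j, measurable (A j)) ->
    P (\big[setI/setT]_(j <- s) (X j @^-1` A j)) =
    (\prod_(j <- s) P (X j @^-1` A j))%E.

(* Laplace law with mean 0 and variance 1: density exp(-sqrt2 |x|)/sqrt2. *)
Definition laplace_density {R : realType} (x : R) : R :=
  (Num.sqrt 2)^-1 * expR (- (Num.sqrt 2 * `|x|)).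

Definition std_laplace_rv {d} {Omega : measurableType d} {R : realType}
  (P : probability Omega R) (X : Omega -> R) : Prop :=
  measurable_fun [set: Omega] X /\
  forall A : set R, measurable A ->
    P (X @^-1` A) = (\int[lebesgue_measure]_(x in A) (laplace_density x)%:E)%E.

Definition is_ICLP {d} {Omega : measurableType d} {R : realType}
  {H : normedModType R} (P : probability Omega R)
  (lam : nat -> R) (phi : nat -> H) (mu : H) (Z : Omega -> H) : Prop :=
  measurable_fun [set: Omega] (Z : Omega -> borelH H) /\
  exists L : nat -> Omega -> R,
    (forall j, std_laplace_rv P (L j)) /\
    mutually_independent P L /\
    (fun n => (\int[P]_w
        (`| Z w - (mu + \sum_(j < n) (Num.sqrt (lam j) * L j w) *: phi j) |
           ^+ 2)%:E)%E) @ \oo --> 0%E.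

Definition lawH {d} {Omega : measurableType d} {R : realType}
  {H : normedModType R} (P : probability Omega R) (X : Omega -> H)
  : set (borelH H) -> \bar R :=
  pushforward P (X : Omega -> borelH H).

Definition equivalent_measures {d} {T : measurableType d} {R : realType}
  (m1 m2 : set T -> \bar R) : Prop := m1 `<< m2 /\ m2 `<< m1.

Definition adjacent_db {Rec : Type} {n : nat} (D D' : 'I_n -> Rec) : Prop :=
  (exists i, D i <> D' i) /\
  (forall i j, D i <> D' i -> D j <> D' j -> i = j).

(* Main.v *)
(* Up to an affine change of variable the question is whether the laws of [Z]
   and [Z + h] are equivalent.  With [a j := <h, phi j> / sqrt (lam j)], shifting
   the first [n] standardised coordinates of [Z] by [a] multiplies its law by
   [rho n = prod_(j < n) r (a j)], where [r a] is the likelihood ratio of the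
   shifted Laplace law, so that [ln (r a)] is bounded by [sqrt 2 * |a|].

   If [sum_j a j ^ 2] converges, [E (rho n ^ 2)] is bounded because
   [E (r a ^ 2) <= exp (O (a ^ 2))].  Hence
   [P (Z + h in U) <= t * C / 2 + P (Z in U) / (2 * t)] for open [U] and [t > 0],
   and outer regularity extends this to null sets.

   If the series diverges, the Hellinger affinities
   [E (sqrt (rho n)) = prod_(j < n) E (sqrt (r (a j)))] tend to [0].  Since
   [P (Z in A)] and [P (Z + h notin A)] are both at most [E (sqrt (rho n))] for
   [A = {rho n >= 1}], Borel-Cantelli along a subsequence shows that the two laws
   are mutually singular. *)

Require Import Defs.
From HB Require Import structures.
From mathcomp Require Import all_boot all_order all_algebra.
From mathcomp Require Import all_classical all_reals all_analysis.
From mathcomp Require Import measurable_realfun.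
From mathcomp Require Import ring lra.
Import Order.TTheory GRing.Theory Num.Theory.
Import numFieldNormedType.Exports.
Local Open Scope classical_set_scope.
Local Open Scope ring_scope.

Set Implicit Arguments. Unset Strict Implicit. Unset Printing Implicit Defensive.

(** * Laws, independence and integration *)

Section laws.
Local Open Scope ereal_scope.

Import HBNNSimple.

(** Simple functions increasing to [f] give the limit. The right-hand side involves [X] and [G] only
    through the integrals of [G] over preimages under [X], which makes integrals over different
    spaces comparable. *)
Lemma integral_comp_limE d d' (T : measurableType d) (S : measurableType d')
    (R : realType) (mu : {measure set T -> \bar R}) (X : T -> S)
    (G : T -> R) (f : S -> R) (mf : measurable_fun [set: S] (EFin \o f)) :
  measurable_fun [set: T] X -> measurable_fun [set: T] G ->
  (forall t, (0 <= G t)%R) -> (forall s, (0 <= f s)%R) ->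
  \int[mu]_t (f (X t) * G t)%:E =
  limn (fun n => \sum_(r \in range (nnsfun_approx measurableT mf n))
    (r%:E * \int[mu]_(t in X @^-1` (nnsfun_approx measurableT mf n @^-1` [set r]))
       (G t)%:E)).
Proof.
move=> mX mG G0 f0; pose f_ := nnsfun_approx measurableT mf.
have mfX n : measurable_fun [set: T] (fun t => f_ n (X t)).
  exact: measurableT_comp.
have mpre n r : measurable (X @^-1` (f_ n @^-1` [set r])).
  by rewrite -[Y in measurable Y]setTI; apply: mX.
transitivity (limn (fun n => \int[mu]_t (f_ n (X t) * G t)%:E)).
  rewrite -monotone_convergence//.
  - apply: eq_integral => t _; apply/esym/cvg_lim => //.
    apply: cvg_EFin; first exact: nearW.
    rewrite [X in X @ _ --> _](_ : _ = (fun n => f_ n (X t) * G t)%R)//.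
    apply: cvgMr_tmp.
    have := @cvg_nnsfun_approx _ _ _ _ measurableT _ mf (fun x _ => f0 x) (X t) I.
    by move=> /fine_cvgP[].
  - by move=> n; apply/measurable_EFinP/measurable_funM.
  - by move=> n t _; rewrite lee_fin mulr_ge0.
  - move=> t _ m n mn; rewrite lee_fin ler_wpM2r//.
    exact/lefP/nd_nnsfun_approx.
apply: congr_lim; apply/funext => n; rewrite -/(f_ n).
transitivity (\int[mu]_t (\sum_(r \in range (f_ n))
    (r%:E * ((EFin \o G) \_ (X @^-1` (f_ n @^-1` [set r]))) t))).
  apply: eq_integral => t _.
  rewrite fimfunE EFinM -fsumEFin// ge0_mule_fsuml; last first.
    by move=> r; rewrite EFinM nnfun_muleindic_ge0.
  apply: eq_fsbigr => r _; rewrite patchE indicE /= EFinM -muleA; congr (_ * _).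
  have -> : (X t \in f_ n @^-1` [set r]) = (t \in X @^-1` (f_ n @^-1` [set r])).
    by apply/idP/idP; rewrite !inE.
  by case: ifPn; rewrite ?mul1e ?mul0e.
rewrite ge0_integral_fsum//.
- apply: eq_fsbigr => r rf.
  rewrite ge0_integralZl//.
  + by rewrite -integral_mkcondl setIT.
  + apply/(measurable_restrictT _ _).1 => //.
    by apply/measurable_EFinP; exact: measurable_funS mG.
  + by move=> t _; apply: erestrict_ge0 => x _ /=; rewrite lee_fin.
  + by move: rf; rewrite inE => -[s _ <-]; rewrite lee_fin.
- move=> r; apply: measurable_funeM.
  apply/(measurable_restrictT _ _).1 => //.
  by apply/measurable_EFinP; exact: measurable_funS mG.
- move=> r t _; rewrite patchE; case: ifPn => [|_]; last by rewrite mule0.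
  by rewrite inE /= => <-; rewrite mule_ge0 ?lee_fin.
Qed.

(** Change of variables between two weighted spaces: the image measures [A |-> \int_(X^-1 A) G]
    determine the integrals of all nonnegative [f]. It serves for densities, for translations and
    for independence. *)
Lemma eq_integral_comp d d1 d2 (T1 : measurableType d1) (T2 : measurableType d2)
    (S : measurableType d) (R : realType)
    (m1 : {measure set T1 -> \bar R}) (m2 : {measure set T2 -> \bar R})
    (X1 : T1 -> S) (X2 : T2 -> S) (G1 : T1 -> R) (G2 : T2 -> R) (f : S -> R) :
  measurable_fun [set: T1] X1 -> measurable_fun [set: T2] X2 ->
  measurable_fun [set: T1] G1 -> measurable_fun [set: T2] G2 ->
  (forall t, (0 <= G1 t)%R) -> (forall t, (0 <= G2 t)%R) ->
  (forall A, measurable A ->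
    \int[m1]_(t in X1 @^-1` A) (G1 t)%:E = \int[m2]_(t in X2 @^-1` A) (G2 t)%:E) ->
  measurable_fun [set: S] f -> (forall s, (0 <= f s)%R) ->
  \int[m1]_t (f (X1 t) * G1 t)%:E = \int[m2]_t (f (X2 t) * G2 t)%:E.
Proof.
move=> mX1 mX2 mG1 mG2 G10 G20 eqA /measurable_EFinP mf f0.
rewrite (integral_comp_limE _ mf)// (integral_comp_limE _ mf)//.
apply: congr_lim; apply/funext => n; apply: eq_fsbigr => r _; congr (_ * _).
exact: eqA.
Qed.

(** Dynkin's pi-lambda argument for two image measures. The full set in [C] equates the total
    masses, and their finiteness allows the subtraction needed for complements. *)
Lemma eq_integral_preimage_pi d d1 d2 (T1 : measurableType d1)
    (T2 : measurableType d2) (S : measurableType d) (R : realType)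
    (m1 : {measure set T1 -> \bar R}) (m2 : {measure set T2 -> \bar R})
    (X1 : T1 -> S) (X2 : T2 -> S) (G1 : T1 -> R) (G2 : T2 -> R)
    (C : set (set S)) :
  measurable_fun [set: T1] X1 -> measurable_fun [set: T2] X2 ->
  measurable_fun [set: T1] G1 -> measurable_fun [set: T2] G2 ->
  (forall t, (0 <= G1 t)%R) -> (forall t, (0 <= G2 t)%R) ->
  @measurable _ S = <<s C >> -> setI_closed C -> C [set: S] ->
  \int[m1]_t (G1 t)%:E < +oo ->
  (forall A, C A ->
    \int[m1]_(t in X1 @^-1` A) (G1 t)%:E = \int[m2]_(t in X2 @^-1` A) (G2 t)%:E) ->
  forall A, measurable A ->
    \int[m1]_(t in X1 @^-1` A) (G1 t)%:E = \int[m2]_(t in X2 @^-1` A) (G2 t)%:E.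
Proof.
move=> mX1 mX2 mG1 mG2 G10 G20 CE CI CT G1oo eqC A mA.
have m1X B : measurable B -> measurable (X1 @^-1` B).
  by move=> mB; rewrite -[Y in measurable Y]setTI; exact: mX1.
have m2X B : measurable B -> measurable (X2 @^-1` B).
  by move=> mB; rewrite -[Y in measurable Y]setTI; exact: mX2.
have mE1 D : measurable_fun D (EFin \o G1).
  by apply/measurable_EFinP; exact: measurable_funS mG1.
have mE2 D : measurable_fun D (EFin \o G2).
  by apply/measurable_EFinP; exact: measurable_funS mG2.
have splitE d' (T : measurableType d') (m : {measure set T -> \bar R})
    (X : T -> S) (G : T -> R) B : measurable (X @^-1` B) ->
    measurable_fun [set: T] (EFin \o G) -> (forall t, (0 <= G t)%R) ->
    \int[m]_t (G t)%:E = \int[m]_(t in X @^-1` B) (G t)%:E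
      + \int[m]_(t in X @^-1` (~` B)) (G t)%:E.
  move=> mB mG G0; rewrite -[in LHS](setUv (X @^-1` B)).
  rewrite ge0_integral_setU//=; [exact: measurableC|by rewrite setUv| |].
  - by move=> x _; rewrite lee_fin.
  - exact/disj_setPCl.
have eqT : \int[m1]_t (G1 t)%:E = \int[m2]_t (G2 t)%:E.
  by have := eqC _ CT; rewrite !preimage_setT.
have addI (x y z : \bar R) : x \is a fin_num -> x + y = x + z -> y = z.
  by move=> xfin /(congr1 (fun u => u - x)) /=; rewrite ![x + _]addeC !addeK.
suff : forall A, <<s C >> A ->
  \int[m1]_(t in X1 @^-1` A) (G1 t)%:E = \int[m2]_(t in X2 @^-1` A) (G2 t)%:E.
  by apply; rewrite -CE.
apply: (dynkin_induction CE) => //.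
- move=> B mB eqB.
  have := eqT; rewrite (splitE _ _ _ X1 _ B)//; last exact: m1X.
  rewrite [RHS](splitE _ _ _ X2 _ B)//; last exact: m2X.
  rewrite -eqB; apply: addI.
  rewrite ge0_fin_numE; last by apply: integral_ge0 => x _; rewrite lee_fin.
  apply: le_lt_trans G1oo; apply: ge0_subset_integral => //.
  + exact: m1X.
  + by move=> x _; rewrite lee_fin.
- move=> F mF tF eqF; rewrite !preimage_bigcup.
  have tX (T : Type) (X : T -> S) : trivIset [set: nat] (fun i => X @^-1` F i).
    apply/trivIsetP => i j _ _ ij; rewrite -preimage_setI.
    by move/trivIsetP : tF => -> //; rewrite preimage_set0.
  rewrite !ge0_integral_bigcup//.
  + by apply: eq_eseriesr => i _; exact: eqF.
  + by move=> k; exact: m2X.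
  + by move=> t _; rewrite lee_fin.
  + by move=> k; exact: m1X.
  + by move=> t _; rewrite lee_fin.
Qed.

Lemma integral_prod_indep d (Omega : measurableType d) (R : realType)
    (P : probability Omega R) (X : nat -> Omega -> R) (f : nat -> R -> R)
    (s : seq nat) :
  mutually_independent P X -> (forall j, measurable_fun [set: Omega] (X j)) ->
  (forall j, measurable_fun [set: R] (f j)) -> (forall j x, (0 <= f j x)%R) ->
  (forall j, \int[P]_w (f j (X j w))%:E < +oo) -> uniq s ->
  \int[P]_w (\prod_(j <- s) f j (X j w))%:E =
  \prod_(j <- s) \int[P]_w (f j (X j w))%:E.
Proof.
move=> indX mX mf f0 foo.
have mXA j (A : set R) : measurable A -> measurable (X j @^-1` A).
  by move=> mA; rewrite -[Y in measurable Y]setTI; exact: mX.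
have mprodf s1 : measurable_fun [set: Omega]
    (fun w => (\prod_(j <- s1) f j (X j w))%R).
  by apply: measurable_prod => j _; exact: measurableT_comp.
have mprodA s2 (A : nat -> set R) : (forall j, measurable (A j)) ->
    measurable_fun [set: Omega] (fun w => \prod_(j <- s2) \1_(A j) (X j w) : R)%R.
  move=> mA; apply: measurable_prod => j _.
  by apply: measurableT_comp => //; exact: measurable_indic.
(* The induction trades functions for indicators: indices in [s1] still carry [f], those in [s2]
   already carry an indicator. With [s1] empty the claim is independence itself. *)
suff gen s1 s2 (A : nat -> set R) : uniq (s1 ++ s2) ->
    (forall j, measurable (A j)) ->
    \int[P]_w (\prod_(j <- s1) f j (X j w) *
               \prod_(j <- s2) \1_(A j) (X j w))%:E =
    \prod_(j <- s1) \int[P]_w (f j (X j w))%:E *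
    \prod_(j <- s2) P (X j @^-1` A j).
  move=> us; have := gen s [::] (fun=> setT).
  rewrite cats0 big_nil mule1 => <- //.
  by apply: eq_integral => w _; rewrite big_nil mulr1.
elim: s1 s2 A => [s2 A us mA|j s1 IH s2 A /= us mA].
  rewrite big_nil mul1e -indX//.
  rewrite -(setIT (\big[_/_]_(_ <- _) _)) -integral_indic//; last first.
    by apply: bigsetI_measurable => i _; exact: mXA.
  apply: eq_integral => w _; rewrite big_nil mul1r; congr EFin.
  elim: (s2) => [|i s' IHs]; first by rewrite !big_nil indicT.
  by rewrite !big_cons indicI /= IHs.
have [js us1] : j \notin s1 ++ s2 /\ uniq (s1 ++ s2) by apply/andP.
pose G w := (\prod_(j <- s1) f j (X j w) * \prod_(j <- s2) \1_(A j) (X j w) : R)%R.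
pose c := fine (\prod_(j <- s1) \int[P]_w (f j (X j w))%:E *
    \prod_(j <- s2) P (X j @^-1` A j)).
have If_ge0 i : 0 <= \int[P]_w (f i (X i w))%:E.
  by apply: integral_ge0 => w _; rewrite lee_fin.
have prodf_fin s' : \prod_(j <- s') \int[P]_w (f j (X j w))%:E \is a fin_num.
  apply: prode_fin_num => i _; rewrite ge0_fin_numE//.
have cE : c%:E = \prod_(j <- s1) \int[P]_w (f j (X j w))%:E *
    \prod_(j <- s2) P (X j @^-1` A j).
  rewrite fineK// fin_numM//; apply: prode_fin_num => i _.
  exact/fin_num_measure/mXA.
have c0 : (0 <= c)%R.
  by rewrite -lee_fin cE mule_ge0//; apply: prode_ge0.
transitivity (\int[P]_w (f j (X j w) * G w)%:E).
  by apply: eq_integral => w _; rewrite big_cons mulrA.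
(* Seen through [X j], the other factors [G] act as the constant weight [c]. It suffices to test
   this on indicators of [X j], and such an indicator joins [s2], where the induction hypothesis
   applies. *)
rewrite (@eq_integral_comp _ _ _ _ _ _ _ P P (X j) (X j) G (cst c))//.
- transitivity (\int[P]_w (c%:E * (f j (X j w))%:E)).
    by apply: eq_integral => w _; rewrite -EFinM mulrC.
  rewrite ge0_integralZl//.
  + by rewrite cE big_cons muleC muleA.
  + by apply/measurable_EFinP; exact: measurableT_comp.
  + by move=> x _; rewrite lee_fin.
- by apply: measurable_funM => //; exact: mprodA.
- by move=> w; rewrite mulr_ge0//; apply: prodr_ge0.
- move=> B mB; transitivity (c%:E * P (X j @^-1` B)); last first.
    by rewrite -integral_cst//; exact: mXA.
  (* Since [j] is not in [s2], this places [B] at index [j] without disturbing the sets at the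
     indices of [s2]. *)
  pose A' i := if i == j then B else A i.
  transitivity (\int[P]_w (\prod_(j <- s1) f j (X j w) *
               \prod_(j <- j :: s2) \1_(A' j) (X j w))%:E).
    rewrite integral_mkcond; apply: eq_integral => w _.
    have E : (\prod_(i <- s2) \1_(A' i) (X i w) =
        \prod_(i <- s2) \1_(A i) (X i w) :> R)%R.
      apply: eq_big_seq => i is2; rewrite /A'; case: eqP => // ij.
      by move: js; rewrite mem_cat -ij is2 orbT.
    rewrite big_cons E /A' eqxx patchE indicE.
    have -> : (X j w \in B) = (w \in X j @^-1` B).
      by apply/idP/idP; rewrite !inE.
    by case: ifPn => _; rewrite ?mul1r// mul0r mulr0.
  rewrite IH; last 2 first.
  + move: us; rewrite cat_uniq /= mem_cat negb_or => /andP[/andP[j1 j2]].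
    rewrite cat_uniq => /and3P[u1 h u2].
    by rewrite u1 u2 j2 /= (negbTE j1)/= h.
  + by move=> i; rewrite /A'; case: ifP.
  rewrite big_cons {1}/A' eqxx cE -muleA; congr (_ * _).
  rewrite muleC; congr (_ * _); apply: eq_big_seq => i is2.
  rewrite /A'; case: eqP => // ij.
  by move: js; rewrite mem_cat -ij is2 orbT.
Qed.
End laws.

(** * The Laplace distribution *)

Section laplace.
Context {R : realType}.
Local Notation mu := lebesgue_measure.

(* [llr k a] is the [k / sqrt 2]-th power of the likelihood ratio of the
   Laplace law shifted by [a]. *)
Definition llr (k a x : R) : R := expR (k * (`|x| - `|x - a|)).

Lemma llr_ge0 k a x : 0 <= llr k a x.
Proof. exact: expR_ge0. Qed.

Lemma measurable_llr k a : measurable_fun [set: R] (llr k a).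
Proof.
apply: measurableT_comp => //; apply: measurable_funM => //.
apply: measurable_funB => //; apply: measurableT_comp => //.
exact: measurable_funB.
Qed.

Lemma llr_sqr k a x : llr (2 * k) a x = llr k a x ^+ 2.
Proof. by rewrite /llr -mulrA (expRM_natl 2). Qed.

Lemma llr_laplace_density a x :
  llr (Num.sqrt 2) a x * laplace_density x = laplace_density (x - a).
Proof.
rewrite /llr /laplace_density mulrCA -expRD; congr (_ * expR _).
by rewrite mulrBr addrAC subrr add0r.
Qed.

(** The exponent [v] of [llr] satisfies [|v| <= k * |a|] by the reverse triangle inequality, and
    [|exp v - 1| <= u * exp u] whenever [|v| <= u]. *)
Lemma llr_sub1_sqr k a x : 0 <= k ->
  (llr k a x - 1) ^+ 2 <= (k * `|a| * expR (k * `|a|)) ^+ 2.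
Proof.
move=> k0; rewrite -[leLHS]real_normK ?num_real//.
rewrite ler_pXn2r ?nnegrE ?mulr_ge0 ?expR_ge0//.
rewrite /llr; pose v := k * (`|x| - `|x - a|); rewrite -/v; set u := k * `|a|.
have : `|v| <= u.
  rewrite /v /u normrM (ger0_norm k0) ler_wpM2l//.
  by have := ler_dist_dist x (x - a); rewrite subKr.
rewrite ler_norml => /andP[uv vu]; have u0 : 0 <= u by rewrite mulr_ge0.
rewrite ler_norml; apply/andP; split; last first.
  have [v0|v0] := leP 0 v.
    have : expR v * (1 - v) <= 1.
      rewrite -[leRHS](expRxMexpNx_1 v) ler_pM2l ?expR_gt0//.
      exact: expR_ge1Dx.
    have : v * expR v <= u * expR u.
      by apply: ler_pM => //; rewrite ?expR_ge0// ler_expR.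
    lra.
  apply: (@le_trans _ _ 0); last by rewrite mulr_ge0 ?expR_ge0.
  by rewrite subr_le0 -expR0 ler_expR ltW.
have := expR_ge1Dx v.
have : u * 1 <= u * expR u by rewrite ler_wpM2l// -expR0 ler_expR.
lra.
Qed.

Lemma laplace_density_ge0 (x : R) : 0 <= laplace_density x.
Proof. by rewrite mulr_ge0 ?expR_ge0// invr_ge0 sqrtr_ge0. Qed.

Lemma measurable_laplace_density : measurable_fun [set: R] (@laplace_density R).
Proof.
apply: measurable_funM => //; apply: measurableT_comp => //.
by apply: measurableT_comp => //; apply: measurable_funM.
Qed.

Lemma lebesgue_measure_addr (a : R) (A : set R) : measurable A ->
  mu ((fun x => x + a) @^-1` A) = mu A.
Proof.
move=> mA; rewrite -[LHS]/(pushforward mu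
  (fun x : measurableTypeR R => x + a : measurableTypeR R) A).
apply/esym/lebesgue_measure_unique => //=.
  exact: measurable_funD.
move=> ? _ [[x y]] _ <-; rewrite /pushforward.
have -> : (fun z => z + a) @^-1` `]x, y]%classic = `]x - a, y - a]%classic.
  by apply/seteqP; split => z /=; rewrite !in_itv/= ltrBlDr lerBrDr.
rewrite !lebesgue_measure_itv/= !lte_fin ltrD2r -!EFinB.
by case: ifP => // _; congr EFin; lra.
Qed.

Lemma ge0_integral_addr (a : R) (f : R -> R) : measurable_fun [set: R] f ->
  (forall x, 0 <= f x) ->
  (\int[mu]_x (f x)%:E = \int[mu]_x (f (x + a))%:E)%E.
Proof.
move=> mf f0.
have := @eq_integral_comp _ _ _ _ _ _ _ mu mu (fun x => x + a) id (cst 1) (cst 1) f.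
transitivity (\int[mu]_x (f (x + a) * cst 1 x)%:E)%E; last first.
  by apply: eq_integral => x _; rewrite mulr1.
transitivity (\int[mu]_x (f (id x) * cst 1 x)%:E)%E.
  by apply: eq_integral => x _; rewrite mulr1.
apply/esym/eq_integral_comp => //.
- exact: measurable_funD.
- move=> A mA; have mA' : measurable ((fun x : R => x + a) @^-1` A).
    by rewrite -[X in measurable X]setTI; apply: measurable_funD.
  rewrite [LHS](integral_cst mu mA' 1) [RHS](integral_cst mu mA 1).
  by congr (_ * _)%E; exact: lebesgue_measure_addr.
Qed.

Lemma probability_integral_cst d (Omega : measurableType d)
    (P : probability Omega R) (k : R) : (\int[P]_w k%:E = k%:E)%E.
Proof.
transitivity (k%:E * P setT)%E; first exact: integral_cst.
by rewrite probability_setT mule1.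
Qed.

Section laplace_rv.
Context d (Omega : measurableType d) (P : probability Omega R) (Y : Omega -> R).
Hypothesis lapY : std_laplace_rv P Y.

Lemma ge0_integral_laplace (f : R -> R) : measurable_fun [set: R] f ->
  (forall x, 0 <= f x) ->
  (\int[P]_w (f (Y w))%:E = \int[mu]_x (f x * laplace_density x)%:E)%E.
Proof.
move=> mf f0; have [mY PY] := lapY.
transitivity (\int[P]_w (f (Y w) * cst 1 w)%:E)%E.
  by apply: eq_integral => x _; rewrite mulr1.
apply: (@eq_integral_comp _ _ _ _ _ _ _ P mu Y id (cst 1)) => //.
- exact: measurable_laplace_density.
- exact: laplace_density_ge0.
- move=> A mA; rewrite preimage_id -PY//.
  have mYA : measurable (Y @^-1` A) by rewrite -[X in measurable X]setTI; apply: mY.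
  by rewrite [LHS](integral_cst P mYA 1) mul1e.
Qed.

(** The ratio turns the Laplace density into its translate by [a], and translation invariance of
    Lebesgue measure moves the translation into the set. *)
Lemma integral_llr_laplace a (A : set R) : measurable A ->
  (\int[P]_w (llr (Num.sqrt 2) a (Y w) * \1_A (Y w))%:E =
   P [set w | A (Y w + a)%R])%E.
Proof.
move=> mA; have [mY PY] := lapY.
have mAa : measurable [set x | A (x + a)].
  rewrite -[X in measurable X]setTI.
  by apply: (@measurable_funD _ _ _ setT id (cst a)) => //; exact: measurable_id.
rewrite (@ge0_integral_laplace (fun x => llr (Num.sqrt 2) a x * \1_A x)).
- transitivity (\int[mu]_x (\1_A x * laplace_density (x - a))%:E)%E.
    apply: eq_integral => x _.
    by rewrite mulrAC llr_laplace_density mulrC.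
  rewrite (@ge0_integral_addr a).
  + transitivity (\int[mu]_x (\1_[set x | A (x + a)] x * laplace_density x)%:E)%E.
      by apply: eq_integral => x _; rewrite addrK !indicE.
    rewrite -(@ge0_integral_laplace (\1_[set x | A (x + a)])) => [| |x].
    * transitivity (\int[P]_w (\1_(Y @^-1` [set x | A (x + a)]) w)%:E)%E => //.
      rewrite integral_indic// ?setIT//.
      by rewrite -[X in measurable X]setTI; exact: mY.
    * exact: measurable_indic.
    * by [].
  + apply: measurable_funM; first exact: measurable_indic.
    apply: measurableT_comp; first exact: measurable_laplace_density.
    exact: measurable_funB.
  + by move=> x; rewrite mulr_ge0 ?laplace_density_ge0.
- by apply: measurable_funM; [exact: measurable_llr|exact: measurable_indic].
- by move=> x; rewrite mulr_ge0 ?llr_ge0.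
Qed.

Lemma integral_llr1 a :
  (\int[P]_w (llr (Num.sqrt 2) a (Y w))%:E = 1)%E.
Proof.
have := @integral_llr_laplace a setT measurableT.
rewrite (_ : [set _ | _] = setT) ?probability_setT; last by apply/seteqP.
by under eq_integral do rewrite indicT mulr1.
Qed.

(** With [r] the likelihood ratio, [E r = 1] gives [E (r ^ 2) = 1 + E ((r - 1) ^ 2) <= 1 + K <= exp
    K]. The pointwise inequality is integrated as [r ^ 2 + 1 <= 2 r + K], so that every integrand is
    nonnegative. *)
Lemma integral_llr_sqr_le a : (\int[P]_w (llr (2 * Num.sqrt 2) a (Y w))%:E <=
  (expR ((Num.sqrt 2 * `|a| * expR (Num.sqrt 2 * `|a|)) ^+ 2))%:E)%E.
Proof.
have [mY _] := lapY; set K := (X in expR X).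
have mllr k : measurable_fun [set: Omega] (fun w => (llr k a (Y w))%:E).
  by apply/measurable_EFinP/measurableT_comp => //; exact: measurable_llr.
have : (\int[P]_w ((llr (2 * Num.sqrt 2) a (Y w))%:E + 1%:E) <=
  \int[P]_w (2%:E * (llr (Num.sqrt 2) a (Y w))%:E + K%:E))%E.
  apply: ge0_le_integral => //.
  - by move=> w _; rewrite adde_ge0 ?lee_fin ?llr_ge0.
  - exact: emeasurable_funD.
  - apply: emeasurable_funD => //; exact: measurable_funeM.
  - move=> w _; rewrite -EFinM -!EFinD lee_fin llr_sqr.
    have := @llr_sub1_sqr (Num.sqrt 2) a (Y w) (sqrtr_ge0 _).
    rewrite -/K; lra.
rewrite !ge0_integralD//; last 4 first.
- by move=> w _; rewrite mule_ge0 ?lee_fin ?llr_ge0.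
- exact: measurable_funeM.
- by move=> w _; rewrite lee_fin sqr_ge0.
- by move=> w _; rewrite lee_fin llr_ge0.
rewrite ge0_integralZl//; last by move=> w _; rewrite lee_fin llr_ge0.
rewrite integral_llr1 !probability_integral_cst mule1 -EFinD.
rewrite -leeBrDr// => /le_trans; apply; rewrite -EFinB lee_fin.
by have := expR_ge1Dx K; lra.
Qed.

Lemma le_laplace_density1 (x : R) : `|x| <= 1 ->
  laplace_density (1 : R) <= laplace_density x.
Proof.
move=> x1; rewrite ler_pM2l ?invr_gt0 ?sqrtr_gt0// ler_expR lerN2.
by rewrite ler_wpM2l ?sqrtr_ge0// normr1.
Qed.

(** The interval has length 1 and lies in [[-1, 1]], where the density is at least its value at
    1. *)
Lemma laplace_unit_interval (x : R) : -1 <= x <= 0 ->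
  ((laplace_density (1 : R))%:E <= P (Y @^-1` `[x, (x + 1)%R]))%E.
Proof.
move=> /andP[x1 x0]; have [_ ->//] := lapY.
apply: (@le_trans _ _
    (\int[mu]_(y in `[x, (x + 1)%R]) (laplace_density (1 : R))%:E)%E).
  rewrite [leRHS](integral_cst mu _ (laplace_density 1)%:E)//=.
  rewrite lebesgue_measure_itv/= lte_fin ltrDl ltr01.
  by rewrite -EFinD addrAC subrr add0r mule1.
apply: ge0_le_integral => //.
- by move=> y _; rewrite lee_fin; exact: laplace_density_ge0.
- by apply/measurable_EFinP; apply: measurable_funTS; exact: measurable_laplace_density.
- move=> y /=; rewrite in_itv/= => /andP[xy yx]; rewrite lee_fin.
  by apply: le_laplace_density1; rewrite ler_norml; apply/andP; split; lra.
Qed.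

(** Let [s] be the square root of the likelihood ratio. Then [E (s ^ 2) = 1], so [2 - 2 E s] equals
    the squared Hellinger distance [E ((s - 1) ^ 2)]. It is bounded below on an event where [s] is
    constant, and [1 - x <= exp (- x)] concludes. *)
Lemma integral_llr_sqrt_le a : (\int[P]_w (llr (Num.sqrt 2 / 2) a (Y w))%:E <=
  (expR (- (laplace_density 1 / 2 *
           (1 - expR (- (Num.sqrt 2 / 2 * `|a|))) ^+ 2)))%:E)%E.
Proof.
have [mY _] := lapY; set e := expR (- (_ * `|a|)); set c := laplace_density 1.
(* [I] is a unit interval on the side of 0 away from [a], where [|y| - |y - a| = - |a|] and hence
   [s = e]. *)
pose x0 : R := if 0 <= a then -1 else 0.
pose I : set R := `[x0, x0 + 1]%classic.
have mllr k : measurable_fun [set: Omega] (fun w => (llr k a (Y w))%:E).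
  by apply/measurable_EFinP/measurableT_comp => //; exact: measurable_llr.
have mYI : measurable (Y @^-1` I).
  by rewrite -[X in measurable X]setTI; apply: mY => //; exact: measurable_itv.
have llrI y : I y -> llr (Num.sqrt 2 / 2) a y = e.
  rewrite /I /x0 /= in_itv/= => yI; rewrite /llr /e -mulrN; congr (expR (_ * _)).
  case: (leP 0 a) yI => a0 /andP[y1 y2].
    rewrite (ger0_norm a0) (ler0_norm (_ : y <= 0)); last by lra.
    by rewrite (ler0_norm (_ : y - a <= 0)); lra.
  rewrite (ltr0_norm a0) (ger0_norm (_ : 0 <= y)); last by lra.
  by rewrite (ger0_norm (_ : 0 <= y - a)); lra.
have : (\int[P]_w (((1 - e) ^+ 2)%:E * (\1_(Y @^-1` I) w)%:E +
      2%:E * (llr (Num.sqrt 2 / 2) a (Y w))%:E) <=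
    \int[P]_w ((llr (Num.sqrt 2) a (Y w))%:E + 1%:E))%E.
  apply: ge0_le_integral => //.
  - by move=> w _; rewrite adde_ge0// mule_ge0 ?lee_fin ?llr_ge0 ?sqr_ge0.
  - apply: emeasurable_funD; apply: measurable_funeM => //.
    by apply/measurable_EFinP; exact: measurable_indic.
  - by apply: emeasurable_funD.
  - move=> w _; rewrite -!EFinM -!EFinD lee_fin.
    have -> : llr (Num.sqrt 2) a (Y w) = llr (Num.sqrt 2 / 2) a (Y w) ^+ 2.
      by rewrite -llr_sqr; congr (llr _ _ _); field.
    rewrite indicE.
    have [|_] := boolP (w \in Y @^-1` I).
      rewrite inE => /llrI -> /=; rewrite mulr1; lra.
    rewrite /= mulr0; have := sqr_ge0 (llr (Num.sqrt 2 / 2) a (Y w) - 1); rewrite add0r; lra.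
have mindic : measurable_fun [set: Omega] (fun w => (\1_(Y @^-1` I) w : R)%:E).
  by apply/measurable_EFinP; exact: measurable_indic.
rewrite !ge0_integralD//; last 5 first.
- by move=> w _; rewrite lee_fin llr_ge0.
- by move=> w _; rewrite mule_ge0 ?lee_fin ?sqr_ge0.
- exact: measurable_funeM.
- by move=> w _; rewrite mule_ge0 ?lee_fin ?llr_ge0.
- exact: measurable_funeM.
rewrite ge0_integralZl//; last by rewrite lee_fin sqr_ge0.
rewrite ge0_integralZl//; last by move=> w _; rewrite lee_fin llr_ge0.
rewrite integral_llr1 integral_indic// setIT probability_integral_cst.
have : (c%:E <= P (Y @^-1` I))%E.
  by apply: laplace_unit_interval; rewrite /x0; case: ifP => _; lra.
have : (0 <= \int[P]_w (llr (Num.sqrt 2 / 2) a (Y w))%:E)%E.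
  by apply: integral_ge0 => w _; rewrite lee_fin llr_ge0.
case: (\int[P]_w _)%E => [s s0 cP|_ cP|//].
  move=> /(le_trans (leeD2r _ (lee_wpmul2l _ cP))).
  rewrite lee_fin sqr_ge0 => /(_ isT).
  rewrite -!EFinM -!EFinD !lee_fin => H; apply: le_trans (expR_ge1Dx _).
  by lra.
rewrite mulry gtr0_sg// mul1e addey//; last first.
  rewrite -ltNye (lt_le_trans ltNy0)// mule_ge0 ?lee_fin ?sqr_ge0//.
Qed.

End laplace_rv.
End laplace.

(** * The Borel sets of a normed space *)

Section borel.
Context {R : realType} {H : normedModType R}.

Lemma open_measurable_borelH (U : set H) : open U -> measurable (U : set (borelH H)).
Proof. by move=> oU; apply: sub_sigma_algebra. Qed.

Lemma measurable_borelH_comp d (T : measurableType d) (X : T -> borelH H)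
    (g : H -> H) : measurable_fun [set: T] X -> continuous g ->
  measurable_fun [set: T] (g \o X : T -> borelH H).
Proof.
move=> mX /continuousP cg; apply: (@measurability _ _ T (borelH H) setT _ (@open H)) => //.
move=> _ [U oU <-]; rewrite comp_preimage; apply: mX => //.
by apply: open_measurable_borelH; exact: cg.
Qed.

Lemma continuous_measurable_borelH (g : H -> R) : continuous g ->
  measurable_fun [set: borelH H] (g : borelH H -> R).
Proof.
move=> /continuousP cg.
apply: (measurability _ (RGenOpens.measurableE R)).
move=> _ [_ [a [b ->]] <-].
rewrite setTI; apply: open_measurable_borelH; apply: cg; exact: interval_open.
Qed.

(** Measurable rectangles in finitely many coordinates: they are closed under intersection, and
    independence evaluates their probabilities as products. *)
Definition cylinder (k : nat -> H -> R) : set (set H) :=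
  [set B | exists m (A : nat -> set R), (forall j, measurable (A j)) /\
     B = [set x | forall j, (j < m)%N -> A j (k j x)]].

Lemma cylinder_setI (k : nat -> H -> R) : setI_closed (cylinder k).
Proof.
move=> _ _ [m [A [mA ->]]] [n [B [mB ->]]].
exists (maxn m n), (fun j => (if (j < m)%N then A j else setT) `&`
  (if (j < n)%N then B j else setT)); split.
  by move=> j; apply: measurableI; case: ifP.
apply/seteqP; split => [x [Ax Bx] j _|x ABx].
  by split; case: ifP => //; [exact: Ax|exact: Bx].
split=> j jm.
  by have := ABx j; rewrite leq_max jm /= => /(_ isT)[].
by have := ABx j; rewrite leq_max jm orbT => /(_ isT)[].
Qed.

Lemma cylinder_setT (k : nat -> H -> R) : cylinder k setT.
Proof.
exists 0%N, (fun=> setT); split => //.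
by apply/seteqP; split.
Qed.

Lemma measurable_cylinder_coord (k : nat -> H -> R) j :
  measurable_fun [set: g_sigma_algebraType (cylinder k)]
    (k j : g_sigma_algebraType (cylinder k) -> R).
Proof.
move=> _ A mA; rewrite setTI; apply: sub_sigma_algebra.
exists j.+1, (fun i => if i == j then A else setT); split.
  by move=> i; case: ifP.
apply/seteqP; split => [x Ax i _|x /(_ j)/=]; first by case: eqP => // ->.
by rewrite eqxx; apply.
Qed.

(* The identity is a pointwise limit of countably valued functions that are
   measurable with respect to the coordinates. *)
Lemma borelH_cylinder (k : nat -> H -> R)
    (v : forall n, {ffun 'I_n -> int} -> H) (b : nat -> R) :
  (forall j, continuous (k j)) ->
  (forall x, v n [ffun j : 'I_n => Num.floor (b n * k j x)] @[n --> \oo] --> x) ->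
  @measurable _ (borelH H) = <<s cylinder k >>.
Proof.
move=> ck vcvg; apply/seteqP; split; last first.
  apply: smallest_sub; first exact: sigma_algebra_measurable.
  move=> _ [m [A [mA ->]]].
  have -> : [set x | forall j, (j < m)%N -> A j (k j x)] =
      \bigcap_(j in [set j | (j < m)%N]) (k j @^-1` A j).
    by apply/seteqP; split => x h j /h.
  apply: bigcap_measurableType => j _; rewrite -[X in measurable X]setTI.
  exact: continuous_measurable_borelH.
pose T := g_sigma_algebraType (cylinder k).
apply: smallest_sub; first exact: (@sigma_algebra_measurable _ T).
move=> U oU; rewrite -/(@measurable _ T U).
pose E n x := v n [ffun j : 'I_n => Num.floor (b n * k j x)].
(* [E n] takes countably many values, each on a set described by finitely many coordinates, so the
   preimage of an arbitrary [S] is measurable. *)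
have mE n (S : set H) : @measurable _ T (E n @^-1` S).
  have -> : E n @^-1` S = \bigcup_(t : {ffun 'I_n -> int})
    (if pselect (S (v n t)) then
       \bigcap_(j in [set: 'I_n]) (fun x => Num.floor (b n * k j x)) @^-1` [set t j]
     else set0).
    apply/seteqP; split => [x Sx|x [t _]].
      exists [ffun j : 'I_n => Num.floor (b n * k j x)] => //.
      by case: pselect => // _ j _ /=; rewrite ffunE.
    case: pselect => // St Ex; rewrite /preimage/= /E.
    suff -> : [ffun j : 'I_n => Num.floor (b n * k j x)] = t by [].
    by apply/ffunP => j; rewrite ffunE; exact: Ex.
  apply: countable_bigcupT_measurable => [|t]; first exact: countableP.
  case: pselect => [Sv|nSv] /=; last exact: measurable0.
  apply: fin_bigcap_measurable => [|j _]; first exact: finite_finset.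
  have -> : (fun x => Num.floor (b n * k j x)) @^-1` [set t j] =
     (fun x : T => b n * k j x) @^-1` `[(t j)%:~R, (t j + 1)%:~R[.
    apply/seteqP; split => x /=; rewrite in_itv/=.
      by move=> <-; apply: real_floor_itv; rewrite num_real.
    exact: floor_def.
  rewrite -[X in measurable X]setTI.
  apply: (measurable_funM (f := cst (b n))) => //.
  exact: measurable_cylinder_coord.
(* Points of [U] with a margin [1 / (i + 1)]. A point is in [U] exactly when, for some [i], its
   approximations eventually stay in [F i]: the margin absorbs the distance from the approximation
   to its limit. *)
pose F (i : nat) := [set y | ball y i.+1%:R^-1 `<=` U].
have -> : U = \bigcup_i \bigcup_N \bigcap_(n in [set n | (N <= n)%N]) E n @^-1` F i.
  apply/seteqP; split => [x Ux|x [i _ [N _ ENx]]].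
    have /nbhs_ballP[e /= e0 eU] : nbhs x U by exact: open_nbhs_nbhs.
    have e20 : 0 < e / 2 by rewrite divr_gt0.
    have [i _ /(_ i (leqnn i)) /= ie] := near_infty_natSinv_lt (PosNum e20).
    have /cvg_ballP /(_ i.+1%:R^-1) := vcvg x.
    rewrite invr_gt0 ltr0n => /(_ isT)[N _ NE].
    exists i => //; exists N => // n /= Nn y Ey; apply: eU.
    apply: (@le_ball _ _ _ (i.+1%:R^-1 + i.+1%:R^-1)).
      by rewrite [leRHS]splitr; apply: lerD; exact: ltW.
    by apply: ball_triangle Ey; exact: NE.
  have /cvg_ballP /(_ i.+1%:R^-1) := vcvg x.
  rewrite invr_gt0 ltr0n => /(_ isT)[M _ ME].
  have := ENx (maxn N M); rewrite /= leq_maxl => /(_ isT); apply.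
  by apply: ball_sym; apply: ME; exact: leq_maxr.
apply: (@bigcupT_measurable _ T) => i; apply: (@bigcupT_measurable _ T) => N.
apply: (@bigcap_measurableType _ T) => n _; exact: mE.
Qed.
End borel.

(** * Outer regularity of laws on a normed space *)

Section regularity.
Context {R : realType} {H : normedModType R}.
Context d (Omega : measurableType d) (P : probability Omega R).
Variable (X : Omega -> borelH H).
Hypothesis mX : measurable_fun [set: Omega] X.

Let mXpre (A : set (borelH H)) : measurable A -> measurable (X @^-1` A).
Proof. by move=> mA; rewrite -[Y in measurable Y]setTI; exact: mX. Qed.

Let mopen (U : set H) : open U -> measurable (X @^-1` U).
Proof. by move=> oU; apply: mXpre; exact: open_measurable_borelH. Qed.

Let mclosed (F : set H) : closed F -> measurable (X @^-1` F).
Proof.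
move=> cF; rewrite -[F]setCK preimage_setC; apply: measurableC.
exact: (mopen (closed_openC cF)).
Qed.

Let exists_measure_lt (F : (set Omega)^nat) (e : R) :
  (forall n, measurable (F n)) -> (forall m n, (m <= n)%N -> F n `<=` F m) ->
  (P (\bigcap_n F n) < e%:E)%E -> exists n, (P (F n) < e%:E)%E.
Proof.
move=> mF dF Fe; apply: contrapT => /forallNP eF.
have cF : P (F i) @[i --> \oo] --> P (\bigcap_n F n).
  apply: nonincreasing_cvg_mu => //; last 2 first.
  - exact: bigcapT_measurable.
  - by move=> m n mn; apply/subsetPset; exact: dF.
  - by rewrite (le_lt_trans (probability_le1 _ _))// ltry.
move: Fe; rewrite ltNge => /negP; apply; rewrite -(cvg_lim _ cF)//.
apply: lime_ge; first by apply/cvg_ex; eexists; exact: cF.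
by apply: nearW => n; rewrite leNgt; apply/negP; exact: eF.
Qed.

(** These sets form a sigma-algebra containing the open sets, hence include all Borel sets. The
    closed inner approximation makes the property stable under complement. *)
Let approximable (B : set H) := forall e : R, 0 < e ->
  exists U F, [/\ open U, closed F, F `<=` B, B `<=` U &
    (P (X @^-1` (U `\` F)) < e%:E)%E].

(** [V i] is the [1 / (i + 1)]-neighbourhood of the complement of [U]. The sets [U] meet [V i]
    decrease to the empty set, so the closed complement of some [V i] fills [U] up to measure
    [e]. *)
Let approximable_open (U : set H) : open U -> approximable U.
Proof.
move=> oU e e0.
pose V i := \bigcup_(z in ~` U) ball z (i.+1%:R^-1 : R).
have oV i : open (V i) by apply: bigcup_open => z _; exact: ball_open.
have UV : \bigcap_i (U `&` V i) = set0.
  apply/seteqP; split => // x UVx; have [Ux _] := UVx 0%N I.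
  have /nbhs_ballP[r /= r0 rU] : nbhs x U by exact: open_nbhs_nbhs.
  have [i _ /(_ i (leqnn i)) /= ir] := near_infty_natSinv_lt (PosNum r0).
  have [_ [z nUz zx]] := UVx i I; apply: nUz; apply: rU.
  by apply: ball_sym; apply: le_ball zx; exact: ltW.
have [|||i Vi] := @exists_measure_lt (fun i => X @^-1` (U `&` V i)) e.
- by move=> i; apply: mopen; exact: openI.
- move=> m n mn; apply: preimage_subset; apply: setIS => x [z nUz zx].
  exists z => //; apply: le_ball zx.
  by rewrite lef_pV2 ?posrE// ler_nat.
- by rewrite -preimage_bigcap UV preimage_set0 measure0.
- exists U, (~` V i); split => //.
  + exact: open_closedC.
  + move=> x nVx; apply: contrapT => nUx; apply: nVx; exists x => //.
    by apply: ballxx; rewrite invr_gt0.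
  + by rewrite setDE setCK.
Qed.

(** The errors of the [A n] share [e / 2] geometrically. The union of all the closed sets may fail
    to be closed, so it is cut to a finite union, and the remaining [e / 2] leaves room for that. *)
Let approximable_bigcup (A : (set H)^nat) :
  (forall n, approximable (A n)) -> approximable (\bigcup_n A n).
Proof.
move=> apA e e0.
have e2 n : 0 < e / 2 / (2 ^ n.+1)%:R by rewrite !divr_gt0// ltr0n expn_gt0.
have /choice[UF UFP] : forall n, exists UF : set H * set H,
    [/\ open UF.1, closed UF.2, UF.2 `<=` A n, A n `<=` UF.1 &
    (P (X @^-1` (UF.1 `\` UF.2)) < (e / 2 / (2 ^ n.+1)%:R)%:E)%E].
  by move=> n; have [U [F ?]] := apA n _ (e2 n); exists (U, F).
pose U := \bigcup_n (UF n).1.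
pose D N := U `\` \bigcup_(n < N) (UF n).2.
have oU : open U by apply: bigcup_open => n _; have [] := UFP n.
have cG N : closed (\bigcup_(n < N) (UF n).2).
  by apply: closed_bigcup => // n _; have [] := UFP n.
have mD V F : open V -> closed F -> measurable (X @^-1` (V `\` F)).
  by move=> oV cF; exact: measurableD (mopen oV) (mclosed cF).
have [|||N DN] := @exists_measure_lt (fun N => X @^-1` (D N)) e.
- by move=> N; exact: mD.
- move=> m n mn; apply: preimage_subset; apply: setDS => x [i /= im ix].
  by exists i => //=; exact: leq_trans mn.
- rewrite -preimage_bigcap.
  apply: (@le_lt_trans _ _ (e / 2)%:E); last by rewrite lte_fin; lra.
  apply: (@le_trans _ _ (\sum_(n <oo) P (X @^-1` ((UF n).1 `\` (UF n).2)))%E).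
    apply: measure_sigma_subadditive.
    + by move=> n; have [? ? _ _ _] := UFP n; exact: mD.
    + by rewrite preimage_bigcap; apply: bigcapT_measurable => N; exact: mD.
    + move=> w /= h; have [[n _ Un] _] := h 0%N I.
      exists n => //=; split => // Fn; have [_] := h n.+1 I; apply.
      by exists n => /=.
  have := @epsilon_trick R (fun=> 0%E) (e / 2) xpredT.
  have e20 : 0 <= e / 2 by lra.
  move=> /(_ (fun=> lexx _) e20); rewrite [X in (_ <= X + _)%E]eseries0// add0e.
  move/(le_trans _); apply.
  apply: lee_nneseries => // n _; rewrite add0e.
  by have [_ _ _ _ /ltW] := UFP n.
- exists U, (\bigcup_(n < N) (UF n).2); split => //.
  + by move=> x [n /= nN Fx]; exists n => //; have [_ _ + _ _] := UFP n; apply.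
  + by move=> x [n _ Ax]; exists n => //; have [_ _ _ + _] := UFP n; apply.
Qed.

Lemma outer_regular (B : set H) : @measurable _ (borelH H) B ->
  forall e : R, 0 < e -> exists U, [/\ open U, B `<=` U &
    (P (X @^-1` U) <= P (X @^-1` B) + e%:E)%E].
Proof.
move=> mB e e0.
have : approximable B.
  move: B mB; apply: smallest_sub; last by move=> U; exact: approximable_open.
  split.
  - by move=> e' e'0; exists set0, set0; split => //;
      [exact: open0|exact: closed0|rewrite setD0 preimage_set0 measure0].
  - move=> A apA e' /apA[U [F [oU cF FA AU UF]]].
    exists (~` F), (~` U); split.
    + exact: closed_openC.
    + exact: open_closedC.
    + by rewrite setTD; exact: subsetC.
    + by rewrite setTD; exact: subsetC.
    + by rewrite setDE setCK setIC -setDE.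
  - by move=> A apA; exact: approximable_bigcup.
move=> /(_ _ e0)[U [F [oU cF FB BU UF]]]; exists U; split => //.
have -> : U = B `|` (U `\` B) by rewrite setDUK.
rewrite preimage_setU; apply: (le_trans (measureU2 _ _ _)).
- exact: mXpre.
- exact: measurableD (mopen oU) (mXpre mB).
apply: leeD => //; apply/ltW; apply: le_lt_trans UF; apply: le_measure.
- rewrite inE; exact: measurableD (mopen oU) (mXpre mB).
- rewrite inE; exact: measurableD (mopen oU) (mclosed cF).
- by apply: preimage_subset; apply: setDS.
Qed.
End regularity.

(** * Coordinates in a Hilbert space *)

Section hilbert.
Context {R : realType} {H : normedModType R}.
Variables (ip : H -> H -> R) (phi : nat -> H).
Hypothesis ipH : is_inner_product ip.
Hypothesis onb : is_ONB ip phi.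

Lemma ipDl x y z : ip (x + y) z = ip x z + ip y z.
Proof. by have [_ [lin _]] := ipH; rewrite -[x]scale1r lin mul1r scale1r. Qed.

Lemma ip0l z : ip 0 z = 0.
Proof. by apply: (addrI (ip 0 z)); rewrite -ipDl !addr0. Qed.

Lemma ipZl a x z : ip (a *: x) z = a * ip x z.
Proof.
by have [_ [lin _]] := ipH; rewrite -[a *: x]addr0 lin ip0l addr0.
Qed.

Lemma ipBl x y z : ip (x - y) z = ip x z - ip y z.
Proof. by rewrite -scaleN1r ipDl ipZl mulN1r. Qed.

Lemma ip_suml (I : Type) (s : seq I) (F : I -> H) z :
  ip (\sum_(i <- s) F i) z = \sum_(i <- s) ip (F i) z.
Proof. by elim/big_rec2 : _ => [|i a b _ <-]; [exact: ip0l|exact: ipDl]. Qed.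

Lemma norm_phi j : `|phi j| = 1.
Proof.
have [_ [_ nrm]] := ipH; have [orth _] := onb.
apply/eqP; rewrite -[_ == 1](@eqrXn2 _ 2)// expr1n -nrm orth eqxx//.
Qed.

(** Bessel's inequality for one vector: the residual [x - c *: phi j] has squared norm
    [|x| ^ 2 - c ^ 2]. *)
Lemma ip_phi_le x j : `|ip x (phi j)| <= `|x|.
Proof.
have [sym [_ nrm]] := ipH; have [orth _] := onb.
set c := ip x (phi j).
have : ip (x - c *: phi j) (x - c *: phi j) = `|x| ^+ 2 - c ^+ 2.
  rewrite ipBl ipZl (sym x) (sym (phi j)) !ipBl !ipZl nrm (sym (phi j) x) -/c.
  by rewrite orth eqxx mulr1; ring.
rewrite nrm => h; rewrite -ler_sqr ?nnegrE// real_normK ?num_real//.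
by have := sqr_ge0 `|x - c *: phi j|; rewrite h subr_ge0.
Qed.

Lemma continuous_ip_phi j : continuous (fun x => ip x (phi j)).
Proof.
move=> x; apply/cvgrPdist_lt => e e0; near=> y.
rewrite -ipBl; apply: le_lt_trans (ip_phi_le _ _) _.
by near: y; apply: cvgr_dist_lt.
Unshelve. all: by end_near. Qed.

Variable lam : nat -> R.
Hypothesis lam0 : forall j, 0 < lam j.

(** In this scale the coordinates of a centred ICLP are standard Laplace, and [in_HC] is square
    summability. *)
Definition std_coord j x := ip x (phi j) / Num.sqrt (lam j).

Lemma sqrt_lam_gt0 j : 0 < Num.sqrt (lam j).
Proof. by rewrite sqrtr_gt0. Qed.

Lemma std_coordD j x y : std_coord j (x + y) = std_coord j x + std_coord j y.
Proof. by rewrite /std_coord ipDl mulrDl. Qed.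

Lemma std_coordB j x y : std_coord j (x - y) = std_coord j x - std_coord j y.
Proof. by rewrite /std_coord ipBl mulrBl. Qed.

Lemma continuous_std_coord j : continuous (std_coord j).
Proof. by move=> x; apply: cvgMr_tmp; exact: continuous_ip_phi. Qed.

Definition std_vec (a : nat -> R) (n : nat) : H :=
  \sum_(j < n) (Num.sqrt (lam j) * a j) *: phi j.

Lemma std_coord_vec a n j :
  std_coord j (std_vec a n) = if (j < n)%N then a j else 0.
Proof.
have [orth _] := onb; rewrite /std_coord ip_suml.
under eq_bigr do rewrite ipZl orth.
case: ltnP => jn; last first.
  rewrite big1 ?mul0r// => i _; case: eqP => [ij|]; rewrite ?mulr0//.
  by have := ltn_ord i; rewrite ij ltnNge jn.
rewrite (bigD1 (Ordinal jn))//= eqxx mulr1 big1 ?addr0; last first.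
  move=> i; rewrite -val_eqE/= => /negbTE ->.
  by rewrite mulr0.
by rewrite mulrAC divff ?mul1r// gt_eqF// sqrt_lam_gt0.
Qed.

Lemma cvg_std_vec_coord x : std_vec (std_coord^~ x) n @[n --> \oo] --> x.
Proof.
have [_ exp] := onb; have := exp x.
apply: cvg_trans; apply: near_eq_cvg; apply: nearW => n; apply: eq_bigr => j _.
by rewrite /std_coord mulrCA divff ?mulr1// gt_eqF// sqrt_lam_gt0.
Qed.

(** Inverse mesh of the grid to which coordinates are rounded. Rounding the first [n] of them moves
    the vector by at most [\sum_(j < n) sqrt (lam j) / b n <= 1 / (n + 1)]; the summand 1 keeps
    [b n] positive. *)
Let b n : R := n.+1%:R * (1 + \sum_(j < n) Num.sqrt (lam j)).

Let b_gt0 n : 0 < b n.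
Proof.
by rewrite mulr_gt0// ltr_wpDr// sumr_ge0// => j _; exact: sqrtr_ge0.
Qed.

Lemma borelH_std_cylinder :
  @measurable _ (borelH H) = <<s cylinder std_coord >>.
Proof.
apply: (@borelH_cylinder _ _ _
  (fun n t => \sum_(j < n) (Num.sqrt (lam j) * ((t j)%:~R / b n)) *: phi j) b).
  exact: continuous_std_coord.
move=> x; apply/cvgrPdist_lt => e e0.
have e20 : 0 < e / 2 by rewrite divr_gt0.
have /cvgrPdist_lt/(_ _ e20) cvx := @cvg_std_vec_coord x.
have cvn := near_infty_natSinv_lt (PosNum e20).
(* Truncating the expansion costs less than [e / 2], and so does rounding the coordinates that are
   kept. *)
near=> n; apply: (le_lt_trans (ler_distD (std_vec (std_coord^~ x) n) _ _)).
rewrite [ltRHS]splitr; apply: ltrD.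
  by near: n; exact: cvx.
rewrite /std_vec -sumrB.
apply: (@le_lt_trans _ _ n.+1%:R^-1); last first.
  by near: n; exact: cvn.
apply: (@le_trans _ _ (\sum_(j < n) Num.sqrt (lam j) / b n)).
  apply: (le_trans (ler_norm_sum _ _ _)); apply: ler_sum => j _.
  rewrite -scalerBl normrZ norm_phi mulr1 -mulrBr normrM ger0_norm ?sqrtr_ge0//.
  rewrite ler_wpM2l ?sqrtr_ge0// ffunE.
  have /andP[f1 f2] := real_floor_itv (num_real (b n * std_coord j x)).
  rewrite intrD mulr1z in f2.
  rewrite -(ler_pM2l (b_gt0 n)) divff ?gt_eqF//.
  rewrite -{1}(gtr0_norm (b_gt0 n)) -normrM mulrBr [X in _ - X]mulrCA divff ?gt_eqF// mulr1.
  rewrite ler_norml; apply/andP; split; lra.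
rewrite -mulr_suml /b invfM mulrCA -[leRHS]mulr1 ler_wpM2l//.
rewrite ler_pdivrMr ?mul1r; first by rewrite lerDr.
by rewrite ltr_wpDr// sumr_ge0// => j _; exact: sqrtr_ge0.
Unshelve. all: by end_near. Qed.

Lemma measurable_std_coordP d (T : measurableType d) (X : T -> borelH H) :
  (forall j, measurable_fun [set: T] (fun w => std_coord j (X w))) ->
  measurable_fun [set: T] X.
Proof.
move=> mX; apply: (measurability _ borelH_std_cylinder).
move=> _ [_ [m [A [mA ->]]] <-].
rewrite setTI [X in measurable X](_ : _ = \bigcap_(j in [set j | (j < m)%N])
  ((fun w => std_coord j (X w)) @^-1` A j)); last first.
  by apply/seteqP; split => w h j /h.
apply: bigcap_measurableType => j _; rewrite -[Y in measurable Y]setTI.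
exact: mX.
Qed.

Lemma measurable_std_coord d (T : measurableType d) (X : T -> borelH H) j :
  measurable_fun [set: T] X ->
  measurable_fun [set: T] (fun w => std_coord j (X w)).
Proof.
move=> mX; apply: (measurableT_comp (f := std_coord j : borelH H -> R)) => //.
by apply: continuous_measurable_borelH; exact: continuous_std_coord.
Qed.

End hilbert.

(** * Coordinates of an ICLP *)

Section iclp.
Context {R : realType} {H : normedModType R}.
Variables (ip : H -> H -> R) (phi : nat -> H) (lam : nat -> R).
Hypothesis ipH : is_inner_product ip.
Hypothesis onb : is_ONB ip phi.
Hypothesis lam0 : forall j, 0 < lam j.
Context d (Omega : measurableType d) (P : probability Omega R).
Variable Z : Omega -> H.
Hypothesis iclpZ : is_ICLP P lam phi 0 Z.

Let measure_eq_off_null (N A B : set Omega) : measurable N ->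
  measurable A -> measurable B -> P N = 0%E ->
  (forall w, ~ N w -> A w <-> B w) -> P A = P B.
Proof.
move=> mN + + N0; suff le A' B' : measurable A' -> measurable B' ->
    (forall w, ~ N w -> A' w -> B' w) -> (P A' <= P B')%E.
  move=> mA mB AB; apply/eqP; rewrite eq_le.
  by rewrite !le// => w Nw; have [? ?] := AB _ Nw.
move=> mA mB AB; apply: (@le_trans _ _ (P (B' `|` N))).
  apply: le_measure; rewrite ?inE//; first exact: measurableU.
  by move=> w Aw; have [Nw|Nw] := pselect (N w); [right|left; exact: AB].
apply: (le_trans (measureU2 _ _ _)) => //.
by rewrite [X in (_ + X)%E](_ : _ = 0%E) ?adde0.
Qed.

Local Notation Y := (fun j w => std_coord ip phi lam j (Z w)).

Lemma measurable_ICLP : measurable_fun [set: Omega] (Z : Omega -> borelH H).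
Proof. by case: iclpZ. Qed.

Lemma measurable_ICLP_coord j : measurable_fun [set: Omega] (Y j).
Proof. exact: measurable_std_coord measurable_ICLP. Qed.

(** For [n > j] the [j]-th coordinate of the remainder [D n] is [sqrt (lam j) * (Y j - L j)],
    independent of [n] and bounded by the norm of [D n]. Convergence in [L^2] forces its second
    moment to be 0. *)
Let coord_ae : exists L : nat -> Omega -> R, [/\ forall j, std_laplace_rv P (L j),
  mutually_independent P L & forall j, exists N, [/\ measurable N, P N = 0%E &
    forall w, ~ N w -> Y j w = L j w]].
Proof.
have [mZ [L [lapL [indL cvL]]]] := iclpZ; exists L; split => // j.
have mL i : measurable_fun [set: Omega] (L i) by have [] := lapL i.
pose D n w := Z w - (0 + \sum_(j < n) (Num.sqrt (lam j) * L j w) *: phi j).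
have coordD n i w : std_coord ip phi lam i (D n w) =
    Y i w - if (i < n)%N then L i w else 0.
  by rewrite /D add0r std_coordB// (@std_coord_vec _ _ _ _ ipH onb _ lam0 (L^~ w)).
have mD n : measurable_fun [set: Omega] (D n : Omega -> borelH H).
  apply: (measurable_std_coordP ipH onb lam0) => i.
  under eq_fun do rewrite coordD; apply: measurable_funB.
    exact: measurable_ICLP_coord.
  by case: (i < n)%N.
pose f w := (Num.sqrt (lam j) * (Y j w - L j w)) ^+ 2.
have mf : measurable_fun [set: Omega] f.
  apply: measurable_funX; apply: measurable_funM => //.
  by apply: measurable_funB => //; exact: measurable_ICLP_coord.
have mnD n : measurable_fun [set: Omega] (fun w => `|D n w| ^+ 2).
  apply: measurable_funX.
  apply: (measurableT_comp (f := (fun x : borelH H => `|x : H|))) (mD n).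
  by apply: continuous_measurable_borelH; exact: norm_continuous.
have fle n : (j < n)%N -> (\int[P]_w (f w)%:E <= \int[P]_w (`|D n w| ^+ 2)%:E)%E.
  move=> jn; apply: ge0_le_integral => //.
  - by move=> w _; rewrite lee_fin sqr_ge0.
  - exact/measurable_EFinP.
  - exact/measurable_EFinP.
  move=> w _; rewrite lee_fin /f.
  have := coordD n j w; rewrite jn => <-.
  rewrite /std_coord mulrCA divff ?mulr1 ?gt_eqF ?sqrt_lam_gt0//.
  by rewrite -[leLHS]real_normK ?num_real// ler_sqr ?nnegrE//; exact: (ip_phi_le ipH onb).
have f0 : (\int[P]_w (f w)%:E = 0)%E.
  apply/eqP; rewrite eq_le; apply/andP; split; last first.
    by apply: integral_ge0 => w _; rewrite lee_fin sqr_ge0.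
  rewrite -(cvg_lim _ cvL)//; apply: lime_ge; first by apply/cvg_ex; exists 0%E.
  by exists j.+1 => // n /= jn; exact: fle.
have mEf : measurable_fun [set: Omega] (EFin \o f) by exact/measurable_EFinP.
have [+ _] := ae_eq_integral_abs P measurableT mEf.
case=> [|N [mN N0 subN]].
  rewrite -f0; apply: eq_integral => w _ /=.
  by rewrite ger0_norm// sqr_ge0.
exists N; split => // w Nw; apply: contrapT => YL; apply: Nw; apply: subN => /=.
move=> /(_ I)[fw0]; have : f w == 0 by rewrite /f; apply/eqP; exact: fw0.
rewrite sqrf_eq0 mulf_eq0 gt_eqF ?sqrt_lam_gt0//=.
by move=> YLw; apply: YL; apply/eqP; rewrite -subr_eq0.
Qed.

(** Countably many exceptional null sets have a null union, off which all [Y j] and [L j] agree. The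
    driving variables are thereby replaced by functions of [Z] itself. *)
Lemma ICLP_coord : (forall j, std_laplace_rv P (Y j)) /\ mutually_independent P Y.
Proof.
have [L [lapL indL /choice[N NP]]] := coord_ae.
have mL i : measurable_fun [set: Omega] (L i) by have [] := lapL i.
have mY := measurable_ICLP_coord.
pose N' := \bigcup_j N j.
have mN' : measurable N' by apply: bigcupT_measurable => j; have [] := NP j.
have N'0 : P N' = 0%E.
  apply/eqP; rewrite eq_le measure_ge0 andbT.
  apply: (@le_trans _ _ (\sum_(j <oo) P (N j))%E).
    by apply: measure_sigma_subadditive => // j; have [] := NP j.
  by rewrite eseries0// => j _ _; have [] := NP j.
have YL w j : ~ N' w -> Y j w = L j w.
  move=> N'w; have [_ _ ->//] := NP j.
  by move=> Nw; apply: N'w; exists j.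
have mpre (X : Omega -> R) (A : set R) : measurable_fun [set: Omega] X ->
    measurable A -> measurable (X @^-1` A).
  by move=> mX mA; rewrite -[B in measurable B]setTI; exact: mX.
split=> [j|s A us mA].
  split=> [|A mA]; first exact: mY.
  rewrite -(lapL j).2//; apply: (measure_eq_off_null mN') => //; try exact: mpre.
  by move=> w N'w; rewrite /preimage/= YL.
have PYL j : P (Y j @^-1` A j) = P (L j @^-1` A j).
  apply: (measure_eq_off_null mN') => //; try exact: mpre.
  by move=> w N'w; rewrite /preimage/= YL.
under [RHS]eq_bigr do rewrite PYL.
rewrite -indL//; apply: (measure_eq_off_null mN') => //.
- by apply: bigsetI_measurable => j _; exact: mpre.
- by apply: bigsetI_measurable => j _; exact: mpre.
- move=> w N'w; elim: (s) => [|j s' IH]; first by rewrite !big_nil.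
  rewrite !big_cons; split=> -[h /IH h']; split => //; move: h;
    by rewrite /preimage/= YL.
Qed.

(** For [k = sqrt 2] this is the density of the law of [Z] shifted in its first [n] coordinates;
    [k = sqrt 2 / 2] and [k = 2 * sqrt 2] give its square root and its square. *)
Definition lr_prod (k : R) (a : nat -> R) n (x : H) : R :=
  \prod_(0 <= j < n) llr k (a j) (std_coord ip phi lam j x).

Lemma lr_prod_ge0 k a n x : 0 <= lr_prod k a n x.
Proof. by apply: prodr_ge0 => j _; exact: llr_ge0. Qed.

Lemma measurable_lr_prod k a n : measurable_fun [set: borelH H] (lr_prod k a n).
Proof.
apply: measurable_prod => j _; apply: measurableT_comp.
  exact: measurable_llr.
by apply: continuous_measurable_borelH; exact: continuous_std_coord.
Qed.

Lemma measurable_lr_prod_ICLP k a n :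
  measurable_fun [set: Omega] (fun w => lr_prod k a n (Z w)).
Proof.
exact: measurableT_comp (measurable_lr_prod k a n) measurable_ICLP.
Qed.

Let integral_llr_lty k a (A : set R) j : measurable A ->
  (\int[P]_w (llr k a (Y j w) * \1_A (Y j w))%:E < +oo)%E.
Proof.
move=> mA; have mY := measurable_ICLP_coord j.
apply: (@le_lt_trans _ _ (\int[P]_w (expR (`|k| * `|a|))%:E)%E); last first.
  by rewrite probability_integral_cst ltry.
apply: ge0_le_integral => //.
- by move=> w _; rewrite lee_fin mulr_ge0 ?llr_ge0.
- apply/measurable_EFinP/measurable_funM.
    exact: measurableT_comp (measurable_llr k a) mY.
  have mi : measurable_fun [set: R] (\1_A : R -> R) by exact: measurable_indic.
  exact: measurableT_comp mi mY.
move=> w _; rewrite lee_fin -[leRHS]mulr1.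
apply: ler_pM; [exact: llr_ge0|by []| |]; last first.
  by rewrite indicE; case: (_ \in _).
rewrite ler_expR; apply: (le_trans (ler_norm _)); rewrite normrM ler_wpM2l//.
by have := ler_dist_dist (Y j w) (Y j w - a); rewrite subKr.
Qed.

Lemma integral_lr_prod k a n : (\int[P]_w (lr_prod k a n (Z w))%:E =
  \prod_(0 <= j < n) \int[P]_w (llr k (a j) (Y j w))%:E)%E.
Proof.
have [_ indY] := ICLP_coord.
apply: (integral_prod_indep (f := fun j => llr k (a j)) (X := Y)) => //.
- exact: measurable_ICLP_coord.
- by move=> j; exact: measurable_llr.
- by move=> j x; exact: llr_ge0.
- move=> j; have := @integral_llr_lty k (a j) setT j measurableT.
  by under eq_integral do rewrite indicT mulr1.
- exact: iota_uniq.
Qed.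

(** Both sides are finite measures of [B], so cylinders suffice. On a cylinder independence factors
    both sides, and each factor is the one-dimensional identity [integral_llr_laplace]. *)
Lemma shifted_law_integral a n (B : set H) : @measurable _ (borelH H) B ->
  (P ((fun w => Z w + std_vec phi lam a n)%R @^-1` B) =
   \int[P]_(w in Z @^-1` B) (lr_prod (Num.sqrt 2) a n (Z w))%:E)%E.
Proof.
move=> mB; pose Zn w := Z w + std_vec phi lam a n.
have [lapY indY] := ICLP_coord.
have coordZn j w : std_coord ip phi lam j (Zn w) =
    Y j w + if (j < n)%N then a j else 0.
  by rewrite /Zn std_coordD// (std_coord_vec ipH onb lam0).
have mZ := measurable_ICLP.
have mZn : measurable_fun [set: Omega] (Zn : Omega -> borelH H).
  apply: (measurable_std_coordP ipH onb lam0) => j.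
  under eq_fun do rewrite coordZn.
  by apply: measurable_funD => //; exact: measurable_ICLP_coord.
have mZnB (C : set H) : @measurable _ (borelH H) C -> measurable (Zn @^-1` C).
  by move=> mC; rewrite -[X in measurable X]setTI; exact: mZn.
rewrite -[LHS]mul1e -integral_cst//; last exact: mZnB.
apply: (eq_integral_preimage_pi (G1 := cst 1) (X1 := Zn : Omega -> borelH H)
  (X2 := Z : Omega -> borelH H) (C := cylinder (std_coord ip phi lam))) => //.
- exact: measurable_lr_prod_ICLP.
- by move=> w; exact: lr_prod_ge0.
- exact: (borelH_std_cylinder ipH onb lam0).
- exact: cylinder_setI.
- exact: cylinder_setT.
- by rewrite probability_integral_cst ltry.
move=> _ [m [A [mA ->]]].
(* The cylinder uses [m] coordinates and the shift [n]. Both are padded to length [M], with zero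
   shifts, whose ratio is 1, and with full sets. *)
pose M := maxn m n; pose a' j := if (j < n)%N then a j else 0.
pose A' j := if (j < m)%N then A j else setT.
have mA' j : measurable (A' j) by rewrite /A'; case: ifP.
have [mM nM] : (m <= M)%N /\ (n <= M)%N by rewrite leq_maxl leq_maxr.
transitivity (\prod_(0 <= j < M) P [set w | A' j (Y j w + a' j)%R])%E.
  have mcyl : @measurable _ (borelH H) [set x | forall j, (j < m)%N ->
      A j (std_coord ip phi lam j x)].
    rewrite (borelH_std_cylinder ipH onb lam0); apply: sub_sigma_algebra.
    by exists m, A.
  rewrite [LHS](integral_cst P (mZnB _ mcyl) 1) mul1e.
  have mA'a j : measurable [set x | A' j (x + a' j)].
    rewrite -[X in measurable X]setTI.
    by apply: (@measurable_funD _ _ _ setT id (cst (a' j))) => //; exact: measurable_id.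
  rewrite -(indY (index_iota 0 M) (fun j => [set x | A' j (x + a' j)]) (iota_uniq _ _) mA'a).
  rewrite -bigcap_seq; congr (P _); apply/seteqP; split.
    move=> w /= Aw j /= _; rewrite /A'; case: ltnP => // jm.
    by have := Aw j jm; rewrite coordZn.
  move=> w /= Aw j jm; have := Aw j; rewrite /= mem_index_iota (leq_trans jm mM).
  by move=> /(_ isT); rewrite /A' jm coordZn.
transitivity (\prod_(0 <= j < M) \int[P]_w
    (llr (Num.sqrt 2) (a' j) (Y j w) * \1_(A' j) (Y j w))%:E)%E.
  by apply: eq_bigr => j _; rewrite integral_llr_laplace.
have mi j : measurable_fun [set: R] (\1_(A' j) : R -> R).
  exact: measurable_indic.
rewrite -(integral_prod_indep (X := Y)
  (f := fun j x => llr (Num.sqrt 2) (a' j) x * \1_(A' j) x))//; last 5 first.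
- exact: measurable_ICLP_coord.
- by move=> j; apply: measurable_funM => //; exact: measurable_llr.
- by move=> j x; rewrite mulr_ge0 ?llr_ge0.
- by move=> j; exact: integral_llr_lty.
- exact: iota_uniq.
rewrite [RHS]integral_mkcond; apply: eq_integral => w _.
rewrite big_split/= (big_cat_nat (leq0n n) nM)//=.
rewrite [X in _ * X * _]big_nat_cond [X in _ * X * _]big1 ?mulr1; last first.
  move=> j /andP[/andP[nj _] _]; rewrite /a' ltnNge nj/=.
  by rewrite /llr subr0 subrr mulr0 expR0.
have -> : \prod_(0 <= j < n) llr (Num.sqrt 2) (a' j) (Y j w) =
    lr_prod (Num.sqrt 2) a n (Z w).
  by apply: eq_big_nat => j /andP[_ jn]; rewrite /a' jn.
rewrite patchE; case: ifPn => [|]; rewrite ?inE ?notin_setE /= => cw.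
  rewrite big1 ?mulr1// => j _; rewrite indicE mem_set// /A'.
  by case: ltnP => // jm; exact: cw.
move: cw => /existsNP[j /not_implyP[jm nA]].
rewrite [X in _ * X](bigD1_seq j) ?iota_uniq//=; last first.
  by rewrite mem_index_iota/= (leq_trans jm).
by rewrite indicE memNset ?mul0r ?mulr0// /A' jm.
Qed.

End iclp.

(** * Equivalence and singularity *)

Section equivalence.
Context {R : realType} {H : normedModType R}.
Variables (ip : H -> H -> R) (phi : nat -> H) (lam : nat -> R).
Hypothesis ipH : is_inner_product ip.
Hypothesis onb : is_ONB ip phi.
Hypothesis lam0 : forall j, 0 < lam j.
Context d (Omega : measurableType d) (P : probability Omega R).
Variable Z : Omega -> H.
Hypothesis iclpZ : is_ICLP P lam phi 0 Z.

Let prode_expR_le (x : nat -> \bar R) (c : nat -> R) n :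
  (forall j, 0 <= x j)%E -> (forall j, x j <= (expR (c j))%:E)%E ->
  (\prod_(0 <= j < n) x j <= (expR (\sum_(0 <= j < n) c j))%:E)%E.
Proof.
move=> x0 xc; elim: n => [|n IH]; first by rewrite !big_nil expR0.
rewrite !big_nat_recr//= expRD EFinM; apply: lee_pmul => //.
by apply: prode_ge0.
Qed.

Let mZ : measurable_fun [set: Omega] (Z : Omega -> borelH H).
Proof. exact: (measurable_ICLP iclpZ). Qed.

Let mZpre (A : set (borelH H)) : measurable A -> measurable (Z @^-1` A).
Proof. by move=> mA; rewrite -[Y in measurable Y]setTI; exact: mZ. Qed.

Let mZshift (h : H) :
  measurable_fun [set: Omega] ((fun w => Z w + h) : Omega -> borelH H).
Proof.
apply: (measurable_borelH_comp (g := fun x => x + h) mZ).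
by move=> x; apply: cvgD; [exact: cvg_id|exact: cvg_cst].
Qed.

Let mZshiftpre (h : H) (A : set (borelH H)) : measurable A ->
  measurable ((fun w => Z w + h) @^-1` A).
Proof. by move=> mA; rewrite -[Y in measurable Y]setTI; exact: mZshift. Qed.

Local Notation lr := (lr_prod ip phi lam).

(* AM-GM: [2 rho <= t rho ^ 2 + 1 / t]. *)
Let shifted_law_le a n (t : R) (B : set H) : 0 < t ->
  @measurable _ (borelH H) B ->
  (P ((fun w => Z w + std_vec phi lam a n)%R @^-1` B) <=
   (t / 2)%:E * \int[P]_w (lr (2 * Num.sqrt 2) a n (Z w))%:E +
   ((2 * t)^-1)%:E * P (Z @^-1` B))%E.
Proof.
move=> t0 mB; rewrite (shifted_law_integral ipH onb lam0 iclpZ)//.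
have mlr k D : measurable_fun D (fun w => (lr k a n (Z w))%:E).
  apply: measurable_funTS; apply/measurable_EFinP.
  exact: (measurable_lr_prod_ICLP ipH onb iclpZ).
have mZB := mZpre mB.
apply: (@le_trans _ _ (\int[P]_(w in Z @^-1` B)
    ((t / 2)%:E * (lr (2 * Num.sqrt 2) a n (Z w))%:E + ((2 * t)^-1)%:E))%E).
  apply: ge0_le_integral => //.
  - by move=> w _; rewrite lee_fin lr_prod_ge0.
  - by apply: emeasurable_funD => //; exact: measurable_funeM.
  move=> w _; rewrite -EFinM -EFinD lee_fin.
  have -> : lr (2 * Num.sqrt 2) a n (Z w) = lr (Num.sqrt 2) a n (Z w) ^+ 2.
    by rewrite /lr_prod -prodrXl; apply: eq_bigr => j _; rewrite llr_sqr.
  set r := lr _ _ _ _; rewrite -subr_ge0.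
  have -> : t / 2 * r ^+ 2 + (2 * t)^-1 - r = (t * r - 1) ^+ 2 / (2 * t).
    by field; rewrite gt_eqF.
  by rewrite mulr_ge0 ?sqr_ge0// invr_ge0 mulr_ge0// ltW.
rewrite ge0_integralD//; last 3 first.
- by move=> w _; rewrite mule_ge0 ?lee_fin ?lr_prod_ge0// divr_ge0// ltW.
- exact: measurable_funeM.
- by move=> w _; rewrite lee_fin invr_ge0 mulr_ge0// ltW.
rewrite integral_cst//; apply: leeD => //.
rewrite ge0_integralZl//; last 2 first.
- by move=> w _; rewrite lee_fin lr_prod_ge0.
- by rewrite lee_fin divr_ge0// ltW.
apply: lee_wpmul2l; first by rewrite lee_fin divr_ge0// ltW.
apply: ge0_subset_integral => //.
by move=> w _; rewrite lee_fin lr_prod_ge0.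
Qed.

(** [Z + std_vec a n] tends to [Z + h] pointwise and [U] is open, so the event for [h] lies in the
    limit inferior of the events for the truncated shifts, whose bound is uniform in [n]. *)
Let shifted_law_open_le (h : H) (C t : R) (U : set H) :
  (forall n, \int[P]_w (lr (2 * Num.sqrt 2) (std_coord ip phi lam ^~ h) n (Z w))%:E
     <= C%:E)%E -> 0 < t -> open U ->
  (P ((fun w => Z w + h)%R @^-1` U) <=
   (t / 2 * C)%:E + ((2 * t)^-1)%:E * P (Z @^-1` U))%E.
Proof.
move=> lrC t0 oU; pose a j := std_coord ip phi lam j h.
have mU := open_measurable_borelH oU.
pose E n := (fun w => Z w + std_vec phi lam a n) @^-1` U.
have mE n : measurable (E n) by exact: mZshiftpre.
have PE n : (P (E n) <= (t / 2 * C)%:E + ((2 * t)^-1)%:E * P (Z @^-1` U))%E.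
  apply: (le_trans (shifted_law_le a n t0 mU)); apply: leeD => //.
  by rewrite [leRHS]EFinM lee_wpmul2l// lee_fin divr_ge0// ltW.
pose D N := \bigcap_(n in [set n | (N <= n)%N]) E n.
have mD N : measurable (D N) by apply: bigcap_measurableType => n _; exact: mE.
have mUD : measurable (\bigcup_N D N) by exact: bigcupT_measurable.
apply: (@le_trans _ _ (P (\bigcup_N D N))).
  apply: le_measure; rewrite ?inE//; first exact: mZshiftpre.
  move=> w /= ZhU.
  have : Z w + std_vec phi lam a n @[n --> \oo] --> Z w + h.
    by apply: cvgD; [exact: cvg_cst|exact: cvg_std_vec_coord].
  have nU : nbhs (Z w + h) U by exact: open_nbhs_nbhs.
  by move=> /(_ _ nU)[N _ NU]; exists N => // n /= Nn; exact: NU.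
have cD : P (D N) @[N --> \oo] --> P (\bigcup_N D N).
  apply: nondecreasing_cvg_mu => //.
  move=> m n mn; apply/subsetPset => w Dw k /= nk; apply: Dw => /=.
  exact: leq_trans mn nk.
rewrite -(cvg_lim _ cD)//; apply: lime_le; first by apply/cvg_ex; eexists; exact: cD.
apply: nearW => N; apply: le_trans (PE N); apply: le_measure; rewrite ?inE//.
by move=> w /(_ N); apply => /=.
Qed.

Lemma integral_lr_prod_HC (h : H) : in_HC ip lam phi h -> exists C : R, forall n,
  (\int[P]_w (lr (2 * Num.sqrt 2) (std_coord ip phi lam ^~ h) n (Z w))%:E <= C%:E)%E.
Proof.
move=> cvh; pose a j := std_coord ip phi lam j h.
pose u j := ip h (phi j) ^+ 2 / lam j.
have uE j : a j ^+ 2 = u j.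
  by rewrite /a /std_coord expr_div_n sqr_sqrtr// ltW.
have u0 j : 0 <= u j by rewrite -uE sqr_ge0.
pose S := limn (series u).
have uS n : series u n <= S.
  apply: nondecreasing_cvgn_le => //; apply: nondecreasing_series => j _ _; exact: u0.
have aS j : `|a j| <= Num.sqrt S.
  rewrite -sqrtr_sqr ler_wsqrtr// uE; apply: le_trans (uS j.+1).
  rewrite /series/= big_nat_recr//= lerDr sumr_ge0// => i _; exact: u0.
(* Since [|a j| <= sqrt S], the exponent in [integral_llr_sqr_le] is at most [K * a j ^ 2]. *)
pose K := expR (Num.sqrt 2 * Num.sqrt S) ^+ 2 * 2.
exists (expR (K * S)) => n.
rewrite (integral_lr_prod ipH onb lam0 iclpZ).
have [lapY _] := ICLP_coord ipH onb lam0 iclpZ.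
apply: (le_trans (prode_expR_le _ _ (fun j => integral_llr_sqr_le (lapY j) (a j)))).
  by move=> j; apply: integral_ge0 => w _; rewrite lee_fin llr_ge0.
rewrite lee_fin ler_expR.
apply: (@le_trans _ _ (\sum_(0 <= j < n) K * u j)); last first.
  by rewrite -mulr_sumr ler_wpM2l ?uS// mulr_ge0// sqr_ge0.
apply: ler_sum => j _; rewrite !exprMn sqr_sqrtr// real_normK ?num_real// uE.
have -> : K * u j = 2 * u j * expR (Num.sqrt 2 * Num.sqrt S) ^+ 2.
  by rewrite /K; ring.
apply: ler_wpM2l; first by apply: mulr_ge0 => //; exact: u0.
rewrite ler_pXn2r ?nnegrE ?expR_ge0// ler_expR.
by rewrite ler_wpM2l ?sqrtr_ge0.
Qed.

Lemma law_shift_dominated (h : H) (B : set H) : in_HC ip lam phi h ->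
  @measurable _ (borelH H) B -> P (Z @^-1` B) = 0%E ->
  P ((fun w => Z w + h) @^-1` B) = 0%E.
Proof.
move=> /integral_lr_prod_HC[C lrC] mB PB0.
have C0 : 0 <= C.
  rewrite -lee_fin; apply: le_trans (lrC 0%N); apply: integral_ge0 => w _.
  by rewrite lee_fin lr_prod_ge0.
apply/eqP; rewrite eq_le measure_ge0 andbT; apply/lee_addgt0Pr => e e0.
(* An open [U] around [B] of measure at most [t ^ 2] yields the bound [t * C / 2 + t / 2], which is
   [e / 2] for this [t]. *)
rewrite add0e; pose t := e / (C + 1).
have t0 : 0 < t by rewrite divr_gt0// ltr_wpDl.
have [U [oU BU PU]] := outer_regular P mZ mB (exprn_gt0 2 t0).
have mU := open_measurable_borelH oU.
apply: (@le_trans _ _ (P ((fun w => Z w + h) @^-1` U))).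
  apply: le_measure; rewrite ?inE; [exact: mZshiftpre|exact: mZshiftpre|].
  exact: preimage_subset.
apply: (le_trans (shifted_law_open_le lrC t0 oU)).
apply: (@le_trans _ _ ((t / 2 * C)%:E + ((2 * t)^-1)%:E * (t ^+ 2)%:E)%E).
  apply: leeD => //; apply: lee_wpmul2l.
    by rewrite lee_fin invr_ge0 mulr_ge0// ltW.
  by apply: (le_trans PU); rewrite PB0 add0e.
rewrite -EFinM -EFinD lee_fin.
have -> : t / 2 * C + (2 * t)^-1 * t ^+ 2 = t * (C + 1) / 2.
  by field; rewrite gt_eqF.
rewrite /t divfK ?gt_eqF ?ltr_wpDl//; lra.
Qed.

(** [1 - exp (- v) >= v / (1 + v)], and the [v j] are bounded because the terms of the convergent
    series tend to 0. So [a j ^ 2] is at most a constant times [q j]. *)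
Let cvg_series_sqr (a : nat -> R) (k : R) : 0 < k ->
  cvg (series (fun j => (1 - expR (- (k * `|a j|))) ^+ 2) @ \oo) ->
  cvg (series (fun j => a j ^+ 2) @ \oo).
Proof.
move=> k0 cq; pose v j := k * `|a j|; pose q j := (1 - expR (- v j)) ^+ 2.
have v0 j : 0 <= v j by rewrite mulr_ge0// ltW.
have le1 j : v j / (1 + v j) <= 1 - expR (- v j).
  rewrite ler_pdivrMr ?ltr_pwDl//.
  have : expR (- v j) * (1 + v j) <= 1.
    rewrite -[leRHS](expRxMexpNx_1 (- v j)) opprK ler_pM2l ?expR_gt0//.
    exact: expR_ge1Dx.
  lra.
(* If [v j > 1] then [1 - exp (- v j) >= 1 / 2], so [q j >= 1 / 4], which happens only finitely
   often. *)
have [N _ Nv] : \forall j \near \oo, v j <= 1.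
  have /cvgrPdist_lt/(_ (1 / 4)) := cvg_series_cvg_0 cq.
  have -> : 0 < 1 / 4 :> R by lra.
  move=> /(_ isT); apply: filterS => j; rewrite -/(v j) sub0r normrN ger0_norm ?sqr_ge0//.
  move=> qj; rewrite leNgt; apply/negP => v1.
  have v2 : 1 / 2 <= v j / (1 + v j).
    by rewrite ler_pdivlMr ?ltr_pwDl//; lra.
  by have := le1 j; nra.
pose M := 1 + \sum_(0 <= j < N) v j.
have M1 : 0 <= M by rewrite addr_ge0// sumr_ge0.
have M0 : 0 < 1 + M by rewrite ltr_pwDl.
have vM j : v j <= M.
  have [jN|jN] := leqP N j.
    by apply: (le_trans (Nv j jN)); rewrite lerDl sumr_ge0.
  rewrite /M (big_cat_nat (leq0n j) (ltnW jN))/= (big_ltn jN)//.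
  have : 0 <= \sum_(0 <= i < j) v i by apply: sumr_ge0.
  have : 0 <= \sum_(j.+1 <= i < N) v i by apply: sumr_ge0.
  lra.
have aq j : a j ^+ 2 <= ((1 + M) / k) ^+ 2 * q j.
  rewrite -[leLHS]real_normK ?num_real// /q -exprMn ler_sqr ?nnegrE//; last first.
    rewrite mulr_ge0 ?divr_ge0 ?(ltW M0) ?(ltW k0)//.
    by apply: le_trans (le1 j); rewrite divr_ge0// addr_ge0.
  have : v j / (1 + M) <= 1 - expR (- v j).
    apply: le_trans (le1 j); rewrite ler_wpM2l// lef_pV2 ?posrE ?ltr_pwDl//.
    by rewrite lerD2l.
  rewrite ler_pdivrMr// /v => h; rewrite mulrAC ler_pdivlMr// mulrC.
  by rewrite [leRHS]mulrC.
apply: (@series_le_cvg _ _ (fun j => ((1 + M) / k) ^+ 2 * q j)).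
- by move=> j; exact: sqr_ge0.
- by move=> j; rewrite mulr_ge0 ?sqr_ge0.
- exact: aq.
- exact: is_cvg_seriesZ.
Qed.

Let half_sqrt2 : 2 * (Num.sqrt 2 / 2) = Num.sqrt 2 :> R.
Proof. by field. Qed.

Let lr_half (a : nat -> R) n x :
  lr (Num.sqrt 2) a n x = lr (Num.sqrt 2 / 2) a n x ^+ 2.
Proof.
rewrite /lr_prod -prodrXl; apply: eq_bigr => j _.
by rewrite -llr_sqr half_sqrt2.
Qed.

Let lr_set (a : nat -> R) n : set H := [set x | 1 <= lr (Num.sqrt 2) a n x].

Let measurable_lr_set a n : @measurable _ (borelH H) (lr_set a n).
Proof.
have -> : lr_set a n = lr (Num.sqrt 2) a n @^-1` `[1, +oo[.
  by apply/seteqP; split => x /=; rewrite in_itv/= andbT.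
rewrite -[X in measurable X]setTI.
have ml : measurable_fun [set: borelH H] (lr (Num.sqrt 2) a n) by exact: measurable_lr_prod.
exact: (ml measurableT _ (measurable_itv _)).
Qed.

Let measurable_lr_half a n (D : set Omega) :
  measurable_fun D (fun w => (lr (Num.sqrt 2 / 2) a n (Z w))%:E).
Proof.
apply: measurable_funTS; apply/measurable_EFinP.
exact: (measurable_lr_prod_ICLP ipH onb iclpZ).
Qed.

(** On this set [rho >= 1], hence [1 <= sqrt rho]. *)
Let lr_set_law_le a n :
  (P (Z @^-1` lr_set a n) <= \int[P]_w (lr (Num.sqrt 2 / 2) a n (Z w))%:E)%E.
Proof.
have mA := mZpre (measurable_lr_set a n).
rewrite -[leLHS]mul1e -integral_cst//.
apply: (@le_trans _ _ (\int[P]_(w in Z @^-1` lr_set a n)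
    (lr (Num.sqrt 2 / 2) a n (Z w))%:E)%E).
  apply: ge0_le_integral => // w; rewrite /lr_set /= lr_half lee_fin.
  have : 0 <= lr (Num.sqrt 2 / 2) a n (Z w) by exact: lr_prod_ge0.
  by nra.
by apply: ge0_subset_integral => // w _; rewrite lee_fin lr_prod_ge0.
Qed.

(** The set depends on the first [n] coordinates only, so [h] may be truncated and the shifted law
    has density [rho]. Off [lr_set], [rho < 1] gives [rho <= sqrt rho]. *)
Let lr_setC_shift_law_le (h : H) n :
  (P ((fun w => Z w + h)%R @^-1` (~` lr_set (std_coord ip phi lam ^~ h) n)) <=
   \int[P]_w (lr (Num.sqrt 2 / 2) (std_coord ip phi lam ^~ h) n (Z w))%:E)%E.
Proof.
set a := std_coord ip phi lam ^~ h.
have mA : @measurable _ (borelH H) (~` lr_set a n).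
  exact: measurableC (measurable_lr_set a n).
have -> : (fun w => Z w + h) @^-1` (~` lr_set a n) =
    (fun w => Z w + std_vec phi lam a n) @^-1` (~` lr_set a n).
  apply/funext => w; rewrite /preimage/= /lr_set/=.
  suff -> : lr (Num.sqrt 2) a n (Z w + h) =
    lr (Num.sqrt 2) a n (Z w + std_vec phi lam a n) by [].
  apply: eq_big_nat => j /andP[_ jn].
  by rewrite !std_coordD// (std_coord_vec ipH onb lam0) jn.
rewrite (shifted_law_integral ipH onb lam0 iclpZ)//.
have mZA := mZpre mA.
apply: (@le_trans _ _ (\int[P]_(w in Z @^-1` (~` lr_set a n))
    (lr (Num.sqrt 2 / 2) a n (Z w))%:E)%E).
  apply: ge0_le_integral => //.
  - by move=> w _; rewrite lee_fin lr_prod_ge0.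
  - apply: measurable_funTS; apply/measurable_EFinP.
    exact: (measurable_lr_prod_ICLP ipH onb iclpZ).
  - move=> w /negP; rewrite -ltNge lr_half lee_fin.
    have : 0 <= lr (Num.sqrt 2 / 2) a n (Z w) by exact: lr_prod_ge0.
    by nra.
by apply: ge0_subset_integral => // w _; rewrite lee_fin lr_prod_ge0.
Qed.

Lemma in_HC_dominated (h : H) :
  (forall B, @measurable _ (borelH H) B -> P (Z @^-1` B) = 0%E ->
    P ((fun w => Z w + h) @^-1` B) = 0%E) ->
  in_HC ip lam phi h.
Proof.
move=> dom; pose a := std_coord ip phi lam ^~ h.
pose c : R := laplace_density 1 / 2.
have c0 : 0 < c by rewrite divr_gt0// mulr_gt0 ?expR_gt0// invr_gt0 sqrtr_gt0.
pose q j := (1 - expR (- (Num.sqrt 2 / 2 * `|a j|))) ^+ 2.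
(* The dichotomy is on [q], the quantity that controls the Hellinger affinities; its convergence
   already gives that of the squares [a j ^ 2]. *)
have [cq|ncq] := pselect (cvg (series q @ \oo)).
  rewrite /in_HC [X in series X](_ : _ = fun j => a j ^+ 2); last first.
    by apply/funext => j; rewrite /a /std_coord expr_div_n sqr_sqrtr// ltW.
  by apply: cvg_series_sqr cq; rewrite divr_gt0// sqrtr_gt0.
exfalso.
have small k : exists n, (\int[P]_w (lr (Num.sqrt 2 / 2) a n (Z w))%:E <=
    (1 / (2 ^ k.+1)%:R)%:E)%E.
  have [lapY _] := ICLP_coord ipH onb lam0 iclpZ.
  (* A partial sum [s] of [q] with [c * s >= 2 ^ (k + 1)] makes the affinity at most
     [exp (- c * s) <= 1 / 2 ^ (k + 1)]. *)
  have /cvgryPge/(_ ((2 ^ k.+1)%:R / c)) : series q @ \oo --> +oo.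
    apply: nondecreasing_dvgn_lt => //.
    by apply: nondecreasing_series => j _ _; exact: sqr_ge0.
  move=> [n _ /(_ n (leqnn n)) /= kq]; exists n.
  rewrite (integral_lr_prod ipH onb lam0 iclpZ).
  apply: (le_trans (prode_expR_le _ _ (fun j => integral_llr_sqrt_le (lapY j) (a j)))).
    by move=> j; apply: integral_ge0 => w _; rewrite lee_fin llr_ge0.
  rewrite lee_fin sumrN expRN div1r lef_pV2 ?posrE ?expR_gt0 ?ltr0n ?expn_gt0//.
  apply: (le_trans _ (expR_ge1Dx _)); rewrite -mulr_sumr.
  by move: kq; rewrite ler_pdivrMr// mulrC => /le_trans; apply; rewrite lerDr.
have [n nP] := choice small.
pose F k := lr_set a (n k).
have mF k : @measurable _ (borelH H) (F k) by exact: measurable_lr_set.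
(* Borel-Cantelli: the probabilities are summable, with total at most 1. *)
have PF0 : P (lim_sup_set (fun k => Z @^-1` F k)) = 0%E.
  apply: lim_sup_set_cvg0 => [k|]; first exact: mZpre.
  apply: (@le_lt_trans _ _ 1%:E); last by rewrite ltry.
  have := @epsilon_trick R (fun=> 0%E) 1 xpredT.
  move=> /(_ (fun=> lexx _) ler01); rewrite [X in (_ <= X + _)%E]eseries0// add0e.
  move/(le_trans _); apply; apply: lee_nneseries => // k _; rewrite add0e.
  exact: le_trans (lr_set_law_le _ _) (nP k).
pose B := lim_sup_set F.
have mB : @measurable _ (borelH H) B.
  apply: bigcapT_measurable => k; apply: bigcup_measurable => j _; exact: mF.
have PhB : P ((fun w => Z w + h) @^-1` B) = 0%E.
  by apply: dom => //; exact: PF0.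
(* The event that [Z + h] misses the limit superior of [F] is the union of the [D N]. Each [D N] is
   null, being contained in events of arbitrarily small probability. *)
pose D N := \bigcap_(k in [set k | (N <= k)%N]) (fun w => Z w + h) @^-1` (~` F k).
have mCF k : measurable ((fun w => Z w + h) @^-1` (~` F k)).
  by apply: mZshiftpre; apply: measurableC; exact: mF.
have mD N : measurable (D N) by apply: bigcap_measurableType => k _; exact: mCF.
have PD0 N : P (D N) = 0%E.
  apply/eqP; rewrite eq_le measure_ge0 andbT; apply/lee_addgt0Pr => e e0.
  rewrite add0e.
  have [M _ Me] := near_infty_natSinv_expn_lt (PosNum e0).
  pose k := maxn N M.
  apply: (@le_trans _ _ (P ((fun w => Z w + h) @^-1` (~` F k)))).
    apply: le_measure; rewrite ?inE// => w /(_ k); apply.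
    exact: leq_maxl.
  apply: (le_trans (lr_setC_shift_law_le _ _)).
  apply: (le_trans (nP k)); rewrite lee_fin; apply/ltW.
  have := Me k.+1; rewrite natrX; apply => /=.
  by rewrite (leq_trans (leq_maxr N M)).
have : (P setT <= P ((fun w => Z w + h)%R @^-1` B) + P (\bigcup_N D N))%E.
  have mUD : measurable (\bigcup_N D N) by exact: bigcupT_measurable.
  have mhB := mZshiftpre h mB.
  apply: le_trans (measureU2 _ mhB mUD); apply: le_measure; rewrite ?inE//.
    exact: measurableU.
  move=> w _; have [Bw|nBw] := pselect (B (Z w + h)); [by left|right].
  move: nBw => /existsNP[N /not_implyP[_ nF]]; exists N => // k /= Nk Fk.
  by apply: nF; exists k.
rewrite PhB add0e => PT; have : (P setT <= 0)%E.
  apply: (le_trans PT); apply: (@le_trans _ _ (\sum_(N <oo) P (D N))%E).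
    by apply: measure_sigma_subadditive => //; exact: bigcupT_measurable.
  by rewrite eseries0.
by rewrite probability_setT lee_fin ler10.
Qed.

End equivalence.

(** * Null sets of laws and affine maps *)

Section laws_on_H.
Context {R : realType} {H : normedModType R}.
Context d (Omega : measurableType d) (P : probability Omega R).

(** Null sets are understood as sets all of whose measurable subsets have measure 0. By
    monotonicity, testing measurable sets of measure 0 is enough. *)
Lemma lawH_dominatesP (X1 X2 : Omega -> H) :
  measurable_fun [set: Omega] (X2 : Omega -> borelH H) ->
  lawH P X1 `<< lawH P X2 <->
  (forall B, @measurable _ (borelH H) B -> P (X2 @^-1` B) = 0%E ->
    P (X1 @^-1` B) = 0%E).
Proof.
move=> mX2; have mX2pre (B : set (borelH H)) : measurable B -> measurable (X2 @^-1` B).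
  by move=> mB; rewrite -[Y in measurable Y]setTI; exact: mX2.
split=> [dom B mB B0|dom A nA B mB BA]; last first.
  by apply: dom => //; exact: (nA B mB BA).
apply: (dom B) => // C mC CB; apply/eqP; rewrite eq_le.
apply/andP; split; last exact: measure_ge0.
have : (P (X2 @^-1` C) <= P (X2 @^-1` B))%E.
  apply: le_measure; rewrite ?inE; [exact: mX2pre|exact: mX2pre|].
  exact: preimage_subset.
by rewrite B0.
Qed.

Lemma continuous_affine (c : R) (h : H) : continuous (fun x : H => h + c *: x).
Proof.
move=> x; apply: cvgD; first exact: cvg_cst.
by apply: cvgZl_tmp; exact: cvg_id.
Qed.

Lemma measurable_affine_preimage (c : R) (h : H) (B : set (borelH H)) :
  measurable B -> @measurable _ (borelH H) ((fun x : H => h + c *: x) @^-1` B).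
Proof.
move=> mB; have mg := @measurable_borelH_comp R H _ (borelH H) id _
  (@measurable_id _ _ _) (@continuous_affine c h).
by rewrite -[Y in measurable Y]setTI; exact: mg.
Qed.

End laws_on_H.

(** * Reduction of the affine laws to the laws of [Z] and [Z + h] *)

Section affine_laws.
Context {R : realType} {H : normedModType R}.
Variables (ip : H -> H -> R) (phi : nat -> H) (lam : nat -> R).
Hypothesis ipH : is_inner_product ip.
Hypothesis onb : is_ONB ip phi.
Hypothesis lam0 : forall j, 0 < lam j.
Context d (Omega : measurableType d) (P : probability Omega R).
Variable Z : Omega -> H.
Hypothesis iclpZ : is_ICLP P lam phi 0 Z.
Variable sigma : R.
Hypothesis sigma0 : 0 < sigma.

Let X f := fun w => f + sigma *: Z w.

Lemma in_HC_scale (c : R) (h : H) :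
  in_HC ip lam phi h -> in_HC ip lam phi (c *: h).
Proof.
move=> hHC; rewrite /in_HC [X in series X](_ : _ =
    c ^+ 2 *: (fun j => ip h (phi j) ^+ 2 / lam j)).
  exact: is_cvg_seriesZ.
by apply/funext => j; rewrite (ipZl ipH) exprMn -mulrA.
Qed.

Lemma measurable_affine_ICLP (f : H) :
  measurable_fun [set: Omega] (X f : Omega -> borelH H).
Proof.
exact: (measurable_borelH_comp (measurable_ICLP iclpZ) (@continuous_affine R H sigma f)).
Qed.

(** With [h = (f - g) / sigma], the map [x |-> g + sigma *: x] carries [Z + h] to [X f] and [Z] to
    [X g]. It and its inverse are continuous, so null sets correspond. *)
Lemma affine_law_dominatedP (f g : H) :
  lawH P (X f) `<< lawH P (X g) <-> in_HC ip lam phi (f - g).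
Proof.
pose h := sigma^-1 *: (f - g).
have sigma_neq0 : sigma != 0 by rewrite gt_eqF.
have ZhE w : Z w + h = sigma^-1 *: (X f w - g).
  by rewrite /X addrAC [RHS]scalerDr -/h scalerA mulVf// scale1r addrC.
have ZE w : Z w = sigma^-1 *: (X g w - g).
  by rewrite /X addrAC subrr add0r scalerA mulVf// scale1r.
have XfE w : X f w = g + sigma *: (Z w + h).
  by rewrite ZhE scalerA divff// scale1r addrC subrK.
split=> [/(lawH_dominatesP P (X f) (measurable_affine_ICLP g)) dom|fgHC].
  have -> : f - g = sigma *: h by rewrite /h scalerA divff// scale1r.
  apply: in_HC_scale; apply: (in_HC_dominated ipH onb lam0 iclpZ) => B mB PB0.
  pose S x := - (sigma^-1 *: g) + sigma^-1 *: x.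
  have SE x : S x = sigma^-1 *: (x - g) by rewrite /S scalerBr addrC.
  have -> : (fun w => Z w + h) @^-1` B = X f @^-1` (S @^-1` B).
    by apply/funext => w; rewrite /preimage/= SE -ZhE.
  apply: dom; first exact: measurable_affine_preimage.
  rewrite -PB0; congr (P _); apply/funext => w.
  by rewrite /preimage/= SE -ZE.
apply/(lawH_dominatesP P (X f) (measurable_affine_ICLP g)) => B mB PB0.
have -> : X f @^-1` B = (fun w => Z w + h) @^-1` ((fun x => g + sigma *: x) @^-1` B).
  by apply/funext => w; rewrite /preimage/= XfE.
apply: (law_shift_dominated ipH onb lam0 iclpZ) => //; first exact: in_HC_scale.
exact: measurable_affine_preimage.
Qed.

(** Domination in one direction already forces membership, and membership is unchanged when [f - g]
    is replaced by its opposite. *)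
Lemma affine_law_equivalentP (f g : H) :
  equivalent_measures (lawH P (X f)) (lawH P (X g)) <-> in_HC ip lam phi (f - g).
Proof.
split=> [[/affine_law_dominatedP//]|fgHC].
split; apply/affine_law_dominatedP => //.
by rewrite -opprB -scaleN1r; exact: in_HC_scale.
Qed.

End affine_laws.

Unset Implicit Arguments.

Theorem theorem2 (R : realType) (H : completeNormedModType R)
  (ip : H -> H -> R) (C : H -> H) (lam : nat -> R) (phi : nat -> H)
  (d : measure_display) (Omega : measurableType d) (P : probability Omega R)
  (Z : Omega -> H) (sigma : R) :
  is_inner_product ip ->
  covariance_eigen ip C lam phi ->
  is_ICLP P lam phi 0 Z ->
  0 < sigma ->
  (forall f g : H,
     equivalent_measures (lawH P (fun w => f + sigma *: Z w))
                         (lawH P (fun w => g + sigma *: Z w))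
     <-> in_HC ip lam phi (f - g)) /\
  (forall (Rec : Type) (n : nat) (DB : set ('I_n -> Rec))
          (fsum : ('I_n -> Rec) -> H) (D D' : 'I_n -> Rec),
     DB D -> DB D' -> adjacent_db D D' ->
     equivalent_measures (lawH P (fun w => fsum D + sigma *: Z w))
                         (lawH P (fun w => fsum D' + sigma *: Z w))
     <-> in_HC ip lam phi (fsum D - fsum D')).
Proof.
move=> ipH [_ [_ [_ [onb [_ [lam0 _]]]]]] iclpZ sigma0.
split=> [f g|Rec n DB fsum D D' _ _ _];
  exact: (affine_law_equivalentP ipH onb lam0 iclpZ sigma0).
Qed.
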